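(* Let $T_n$ be the fractional split tree with $n$ balls and parameters $b,s,s_0,s_1$ and split vector $\mathcal V=(V_1,\dots,V_b)$. Let $\phi$ be a toll function such that $\phi(T_n^v)$, $v\in[b]^*$, is a function of $n_{v1},\dots,n_{vb}$ and such that $\mathbb E[\phi(T_n)^2]=O(n^{2(\beta-\delta)})$ for some $\delta>0$; assume that $\varpi=\varpi[\phi]$ is bounded away from zero, and that $\sum_{i=1}^bV_i^\beta=1$ a.s. Then, with $X_n=X_n(\phi)$, as $n\to\infty$, $$\frac{X_n-\mathbb E[X_n]}{n^\beta\varpi(\ln n)}\longrightarrow0\quad\text{in }L_2 .$$
   Context: Fractional split trees. Fix integers $b\ge2$, $s\ge1$, $s_0\ge0$, $s_1\ge0$ with $0\le bs_1\le s+1-s_0$, and a random vector $\mathcal V=(V_1,\dots,V_b)$ (the split vector) with $V_i\ge0$ and $\sum_{i=1}^bV_i\le1$; if $\sum_iV_i=1$ a.s. the model is called a split tree. Let $V_{(1)}\ge\dots\ge V_{(b)}$ be the entries of $\mathcal V$ in decreasing order. Standing assumptions: $\mathbb P(V_{(1)}=1)<1$, $\mathbb P(V_{(b)}>0)>0$ and $\sum_{i=1}^b\mathbb P(V_i>0)>1$. Nodes are the finite words over $[b]=\{1,\dots,b\}$, i.e. elements of $[b]^*=\bigcup_{m\ge0}[b]^m$; the root is the empty word and the children of $v$ are $v1,\dots,vb$. Every node $u$ receives an independent copy $\mathcal V^{(u)}$ of $\mathcal V$. The tree with $n\ge1$ balls is described by counts $n_v$, $v\in[b]^*$: the root has count $n$;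 if $n_v\le s$, all proper descendants of $v$ have count $0$; if $n_v>s$, then conditionally on $n_v$ and $\mathcal V^{(v)}=(V_1,\dots,V_b)$, $(n_{v1},\dots,n_{vb})$ is distributed as the first $b$ coordinates of $\mathrm{Mult}\bigl(n_v-s_0-bs_1;\,V_1,\dots,V_b,1-\sum_iV_i\bigr)+(s_1,\dots,s_1,0)$, with the usual independence between different subtrees. $T_n$ is the set of nodes $v$ with $n_v>0$ (together with the ball counts); $T_0$ is empty. For $v\in T_n$, the fringe subtree $T_n^v$ is $v$ together with all its descendants in $T_n$; conditionally on $n_v=m$ it is distributed as $T_m$. Additive functionals. A toll function $\phi$ is a real-valued function on trees with balls. Put $\phi_m=\mathbb E[\phi(T_m)]$ for $m\ge1$ and $X_n(\phi)=\sum_{v\in T_n}\phi(T_n^v)$. Parameters. $\beta\in(0,1]$ is the unique number with $\mathbb E\sum_{i=1}^bV_i^\beta=1$. $V:=V_I$ with $I$ uniform on $[b]$ independent of $\mathcal V$. The lattice case is that there is $d>0$ with $\ln V\in d\mathbb Z$ a.s. on $\{V>0\}$; then $d$ denotes the largest such number. Otherwise we are in the nonlattice case and $d:=0$. For a toll function with $\phi_n=O(n^{\beta-\delta})$ for some $\delta>0$, $\varpi[\phi]$ denotes the (existing and unique) bounded, continuous, $d$-periodic function $\mathbb R\to\mathbb R$ (a constant in the nonlattice case) with $\mathbb E[X_n(\phi)]=\varpi[\phi](\ln n)n^\beta+o(n^\beta)$. *)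

(* Defs.v *)
From HB Require Import structures.
From mathcomp Require Import all_boot all_order all_algebra.
From mathcomp Require Import all_classical all_reals all_analysis.

Set Implicit Arguments.
Unset Strict Implicit.
Unset Printing Implicit Defensive.

Import Order.TTheory GRing.Theory Num.Theory.
Import numFieldNormedType.Exports.

Local Open Scope classical_set_scope.
Local Open Scope ring_scope.

(* Nodes are the finite words over [b]; the children of [v] are the words
   [rcons v i].  A configuration of balls is given by its counts [n_v]. *)
Definition node (b : nat) := seq 'I_b.
Definition counts (b : nat) := node b -> nat.

(* [T^v], re-rooted at the empty word. *)
Definition fringe (b : nat) (t : counts b) (v : node b) : counts b :=
  fun w => t (v ++ w).

(* At most [s] balls at a node: nothing strictly below it.  As [0 <= s], the
   set of nodes with a positive count is then closed under prefixes. *)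
Definition ball_tree (b s : nat) (t : counts b) : Prop :=
  forall v w : node b, (t v <= s)%N -> w != [::] -> t (v ++ w) = 0%N.

Definition tree_nodes (b : nat) (t : counts b) : set (node b) :=
  [set v | (0 < t v)%N].

(* The sum is finite for a finite tree, and split trees are a.s. finite; if
   infinitely many summands are nonzero, [\sum_(_ \in _)] takes the value 0. *)
Definition additive_functional (R : realType) (b : nat)
    (phi : counts b -> R) (t : counts b) : R :=
  \sum_(v \in tree_nodes t) phi (fringe t v).

(* The toll of a nonempty tree with balls is a function of the ball counts of
   the children of its root; its values at other count functions are
   irrelevant. *)
Definition toll_of_children (R : realType) (b s : nat) (phi : counts b -> R) :
    Prop :=
  exists f : {ffun 'I_b -> nat} -> R, forall t : counts b,
    ball_tree s t -> (0 < t [::])%N -> phi t = f [ffun i => t [:: i]].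

(* Probability that the first [b] coordinates of
   Mult(m; p_1, ..., p_b, 1 - \sum_i p_i) are [j_1, ..., j_b]. *)
Definition multinomial_pmf (R : realType) (b m : nat) (p : 'I_b -> R)
    (j : 'I_b -> nat) : R :=
  let r := (m - \sum_(i < b) j i)%N in
  if (\sum_(i < b) j i <= m)%N then
    (m`!)%:R / ((\prod_(i < b) (j i)`!)%N%:R * (r`!)%:R)
    * (\prod_(i < b) p i ^+ j i * (1 - \sum_(i < b) p i) ^+ r)
  else 0.

(* Conditional probability that the children of a node have counts [l], given
   that the node has count [a] and split vector [p]. *)
Definition offspring_pmf (R : realType) (b s s0 s1 a : nat) (p : 'I_b -> R)
    (l : 'I_b -> nat) : R :=
  if (a <= s)%N then ([forall i, l i == 0%N])%:R
  else if [forall i, (s1 <= l i)%N] then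
    multinomial_pmf (a - s0 - b * s1) p (fun i => (l i - s1)%N)
  else 0.

Section split_vector.
Context (R : realType) (b : nat) (d0 : measure_display)
  (Om0 : measurableType d0) (P0 : probability Om0 R)
  (V : 'I_b -> {RV P0 >-> R}).

(* [order_stat k] is V_(k+1), the entries being sorted decreasingly. *)
Definition order_stat (k : nat) (x : Om0) : R :=
  nth 0 (sort >=%R [seq V i x | i <- enum 'I_b]) k.

Definition split_vector_axioms : Prop :=
  [/\ forall x, (forall i, 0 <= V i x) /\ \sum_(i < b) V i x <= 1,
      (P0 [set x | order_stat 0 x = 1%R] < 1)%E,
      (0 < P0 [set x | (0 < order_stat b.-1 x)%R])%E
    & (1 < \sum_(i < b) P0 [set x | (0 < V i x)%R])%E].

(* The law of V_I, for I uniform on [b] and independent of the vector. *)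
Definition law_VI (B : set R) : \bar R :=
  (\sum_(i < b) (b%:R^-1)%:E * P0 (V i @^-1` B))%E.

Definition lattice_span (d : R) : Prop :=
  0 < d /\
  law_VI [set x | 0 < x /\ ~ exists z : int, ln x = d * z%:~R] = 0%E.

(* [d] is the largest lattice span, or 0 if there is none. *)
Definition is_span (d : R) : Prop :=
  (lattice_span d /\ forall d', lattice_span d' -> d' <= d)
  \/ (d = 0 /\ forall d', ~ lattice_span d').

Definition is_beta (beta : R) : Prop :=
  0 < beta <= 1 /\
  ('E_P0[fun x => (\sum_(i < b) (V i x) `^ beta)%R] = 1)%E.

(* The probability, for a node with count [a], that its split vector lies in
   the box [B_1 x ... x B_b] and that its children have counts [l]. *)
Definition split_kernel (s s0 s1 a : nat) (B : 'I_b -> set R)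
    (l : 'I_b -> nat) : R :=
  Rintegral P0 [set x | forall i, B i (V i x)]
    (fun x => offspring_pmf s s0 s1 a (fun i => V i x) l).

Section split_tree.
Context (d : measure_display) (Om : measurableType d) (P : probability Om R)
  (W : node b -> 'I_b -> {RV P >-> R}) (N : node b -> {RV P >-> nat}).

(* Generators of the sigma-algebra of the first [m] generations: the counts
   of the nodes of depth at most [m] and the split vectors of the nodes of
   depth less than [m]. *)
Definition history_gen (m : nat) : set (set Om) :=
  [set A | exists u j, (size u <= m)%N /\ A = N u @^-1` [set j]] `|`
  [set A | exists u i B,
     [/\ (size u < m)%N, measurable B & A = W u i @^-1` B]].

(* [W u] is the split vector of the node [u] and [N u] its count.  The last
   clause is the branching property: conditionally on the first [m]
   generations, the pairs (split vector of v, counts of the children of v),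
   for v of depth [m], are independent; the split vector of v is a copy of
   [V], and, given it and n_v, the children have law [offspring_pmf].  Boxes
   suffice, since they form a pi-system generating the Borel sets of R^b. *)
Definition is_split_tree (s s0 s1 n : nat) : Prop :=
  [/\ forall x, N [::] x = n,
      forall x, ball_tree s (N ^~ x)
    & forall (m : nat) (A : set Om), <<s history_gen m >> A ->
      forall (B : m.-tuple 'I_b -> 'I_b -> set R)
             (l : m.-tuple 'I_b -> 'I_b -> nat),
        (forall v i, measurable (B v i)) ->
        P (A `&` [set x | forall (v : m.-tuple 'I_b) i,
                    B v i (W v i x) /\ N (rcons v i) x = l v i])
        = (\int[P]_(x in A)
            (\prod_(v : m.-tuple 'I_b)
               split_kernel s s0 s1 (N v x) (B v) (l v))%:E)%E].

End split_tree.
End split_vector.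

(* [w] is the function varpi attached to the expectations [E n] = E[X_n]. *)
Definition is_varpi (R : realType) (d beta : R) (E : nat -> \bar R)
    (w : R -> R) : Prop :=
  [/\ bounded_fun w, continuous w,
      periodic w d /\ (d = 0 -> exists c, forall x, w x = c),
      forall n, (0 < n)%N -> E n \is a fin_num
    & (fun n : nat => fine (E n) - w (ln n%:R) * n%:R `^ beta)
        =o_\oo (fun n : nat => n%:R `^ beta)].

(* Convergence to 0 in L_2; the first variables of the sequence do not
   matter. *)
Definition cvg0_L2 (R : realType) (d : measure_display)
    (Om : measurableType d) (P : probability Om R) (Y : nat -> Om -> R) :
    Prop :=
  (\forall n \near \oo, Y n \in Lfun P 2%:E) /\
  ('N[P]_2%:E[EFin \o Y n] @[n --> \oo] --> 0)%E.

(* Main.v *)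
Require Import Defs.
From mathcomp Require Import all_boot all_order all_algebra.
From mathcomp Require Import all_classical all_reals all_analysis.
From mathcomp Require Import measurable_realfun.
From mathcomp Require Import ring lra zify.
Set Implicit Arguments.
Unset Strict Implicit.
Unset Printing Implicit Defensive.
Import Order.TTheory GRing.Theory Num.Theory.
Import numFieldNormedType.Exports.
Local Open Scope classical_set_scope.
Local Open Scope ring_scope.

(** Fix the number [n] of balls.  Let [mu a] be the mean of the functional on a
    tree with [a] balls and, at a node [v] with [a] balls whose children have
    counts [l], let [xi_v = toll + \sum_i mu (l i) - mu a].  As [mu] satisfies
    [mu a = E [toll + \sum_i mu (l i)]], the [xi_v] are centred given the past,
    and the sums over the first [k] generations
<<
      M_k = \sum_(|v| < k) toll_v + \sum_(|v| = k) mu (n_v)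
          = mu n + \sum_(|v| < k) xi_v
>>
    have pairwise orthogonal increments ([orthogonal], [variance_sum]).  The
    tree is a.s. finite, so [M_k] is eventually equal to the functional, and
    Fatou's lemma bounds its variance by [E \sum_v sig (n_v)], where [sig a] is
    the variance of [xi] at a node with [a] balls ([limit_var]).  Two facts
    about a single split now suffice.

    The first is [sig a = o (a^(2 beta))] ([toll_variance_small]).  The toll is
    negligible by assumption.  By the law of large numbers the proportions
    [l i / a] are close to the [V_i]; since [varpi] is unchanged by translation
    by [ln V_i], the sum of the [mu (l i)] is close to
    [varpi (ln a) a^beta \sum_i V_i^beta], and the last sum is 1 almost surely:
    knowing the split does not change the prediction of the functional.

    The second is that [E \sum_i V_i^gam < 1] for [gam > beta]
    ([moment_lt1]), so that [a^gam] is strictly superharmonic for the splitting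
    of a large node.  Hence there is a function [h] with
    [sig a + E \sum_i h (l i) <= h a] for all [a], of the form
    [h a = e / 2 * a^(2 beta) + C psi a], where [psi a = O (a^gam)] with
    [beta < gam < 2 beta] dominates the expected number of nodes and absorbs
    the small nodes ([size_bound], [variance_majorant]).  Adding up the
    generations gives a variance at most [h n <= e n^(2 beta)] for large [n],
    which is the claim because [varpi] is bounded away from 0.

    The trees for different numbers of balls are not related to each other, so
    the equation for the means needs an argument.  It is solved for all counts
    up to a given one ([offspring_poisson]); the martingale above, formed with
    the solution, shows that the solution is the mean ([functional_mean]). *)

(** * Expectations under a multinomial law *)
Section multinomial.
Context (R : realType) (b : nat).
Implicit Types (p : 'I_b -> R) (g : {ffun 'I_b -> nat} -> R)
  (j c : {ffun 'I_b -> nat}).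

Definition addc c j : {ffun 'I_b -> nat} := [ffun k => (j k + c k)%N].
Definition subc c j : {ffun 'I_b -> nat} := [ffun k => (j k - c k)%N].
Definition unitc (i : 'I_b) : {ffun 'I_b -> nat} := [ffun k => (k == i) : nat].
Definition constc (a : nat) : {ffun 'I_b -> nat} := [ffun=> a].

Lemma addc_eq c j l : (addc c j == l) = [forall k, (c k <= l k)%N] && (j == subc c l).
Proof.
apply/eqP/andP => [<-|[/forallP cl /eqP ->]].
  split; first by apply/forallP => k; rewrite ffunE leq_addl.
  by apply/eqP/ffunP => k; rewrite !ffunE addnK.
by apply/ffunP => k; rewrite !ffunE subnK.
Qed.

Lemma unitc_le i l : [forall k, (unitc i k <= l k)%N] = (0 < l i)%N.
Proof.
apply/forallP/idP => [/(_ i)|li k]; rewrite ffunE ?eqxx//.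
by case: eqP => // ->.
Qed.

Lemma sum_unitc i : (\sum_k unitc i k = 1)%N.
Proof.
by rewrite (bigD1 i)//= big1 ?ffunE ?eqxx// => k /negPf ki; rewrite ffunE ki.
Qed.

Lemma sum_addc c j : (\sum_k addc c j k = \sum_k j k + \sum_k c k)%N.
Proof. by rewrite -big_split; apply: eq_bigr => k _; rewrite ffunE. Qed.

(** The expectation of [g] under the multinomial law, computed by throwing the
    balls one at a time.  Moments follow by induction on the number of balls,
    without summation over the multinomial coefficients. *)
Fixpoint mult_exp (m : nat) p g : R :=
  if m is m'.+1 then
    \sum_i p i * mult_exp m' p (fun j => g (addc (unitc i) j))
    + (1 - \sum_i p i) * mult_exp m' p g
  else g (constc 0).

Lemma eq_mult_exp m p g g' : g =1 g' -> mult_exp m p g = mult_exp m p g'.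
Proof.
elim: m g g' => [|m IH] g g' gg' /=; first exact: gg'.
congr (_ + _ * _); last exact: IH.
by apply: eq_bigr => i _; congr (_ * _); apply: IH.
Qed.

Lemma mult_expZ m p k g : mult_exp m p (fun j => k * g j) = k * mult_exp m p g.
Proof.
elim: m g => [|m IH] g //=.
rewrite mulrDr mulr_sumr IH mulrCA; congr (_ + _).
by apply: eq_bigr => i _; rewrite (IH (fun j => g (addc (unitc i) j))) mulrCA.
Qed.

Lemma mult_expD m p g g' :
  mult_exp m p (fun j => g j + g' j) = mult_exp m p g + mult_exp m p g'.
Proof.
elim: m g g' => [|m IH] g g' //=.
rewrite IH mulrDr addrACA; congr (_ + _).
rewrite -big_split; apply: eq_bigr => i _ /=; rewrite -mulrDr.
by rewrite (IH (fun j => g (addc (unitc i) j))).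
Qed.

Lemma mult_exp_cst m p k : mult_exp m p (fun=> k) = k.
Proof.
elim: m => //= m IH; rewrite IH -mulr_suml -mulrDl.
by rewrite addrC subrK mul1r.
Qed.

(** The recursion behind Pascal's triangle: condition on the urn of one ball.
    In terms of a common factor [Pr], the summand of urn [i] is [l i] times
    [m`! * Pr], that of the remaining urn is [r] times it, and
    [\sum_i l i + r = m.+1]. *)
Lemma multinomial_pmfS m p (l : {ffun 'I_b -> nat}) :
  multinomial_pmf m.+1 p l =
    \sum_i p i * ((0 < l i)%:R * multinomial_pmf m p (subc (unitc i) l))
    + (1 - \sum_i p i) * multinomial_pmf m p l.
Proof.
set q := 1 - \sum_i p i.
set Sl := (\sum_i l i)%N.
have Ssub i : (0 < l i)%N -> (\sum_k subc (unitc i) l k = Sl.-1)%N.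
  move=> li; have : addc (unitc i) (subc (unitc i) l) = l.
    by apply/eqP; rewrite addc_eq unitc_le li eqxx.
  by move/(congr1 (fun h : {ffun _} => \sum_k h k)%N); rewrite sum_addc sum_unitc addn1 -/Sl => <-.
have S0 i : (0 < l i)%N -> (0 < Sl)%N.
  by move=> li; rewrite /Sl (bigD1 i)//= addn_gt0 li.
have [Slm|Slm] := ltnP m.+1 Sl.
  rewrite [LHS]/multinomial_pmf -/Sl.
  rewrite (ltn_geF Slm)/= [X in q * X]/multinomial_pmf -/Sl (ltn_geF (ltnW Slm)).
  rewrite mulr0 addr0 big1// => i _.
  have [li|] := ltnP 0 (l i); last by rewrite mul0r mulr0.
  rewrite /multinomial_pmf Ssub// leqNgt -ltnS prednK ?(S0 i)// Slm.
  by rewrite mulr0 mulr0.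
pose r := (m.+1 - Sl)%N.
pose Pr := (\prod_(i < b) p i ^+ l i * q ^+ r) /
   ((\prod_(i < b) (l i)`!)%N%:R * (r`!)%:R).
have fne (n : nat) : (n`!)%:R != 0 :> R by rewrite pnatr_eq0 -lt0n fact_gt0.
have Pne (h : 'I_b -> nat) : (\prod_(i < b) (h i)`!)%N%:R != 0 :> R.
  by rewrite pnatr_eq0 -lt0n prodn_gt0// => i; rewrite fact_gt0.
have -> : multinomial_pmf m.+1 p l = (m.+1)`!%:R * Pr.
  rewrite /multinomial_pmf -/Sl Slm -/r -/q /Pr.
  by rewrite mulrAC -mulrA.
have pmf_i i : p i * ((0 < l i)%:R * multinomial_pmf m p (subc (unitc i) l)) = m`!%:R * ((l i)%:R * Pr).
  have [li|] := ltnP 0 (l i); last first.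
    by rewrite leqn0 => /eqP ->; rewrite !mul0r !mulr0.
  have Sl0 := S0 _ li.
  rewrite /multinomial_pmf Ssub// -ltnS prednK// Slm.
  have -> : (m - Sl.-1 = r)%N by rewrite /r; lia.
  rewrite -/q /Pr mul1r.
  rewrite (bigD1 i)//= [X in _ = _ * (_ * (X * _ / _))](bigD1 i)//=.
  rewrite (bigD1 i (F := fun k => p k ^+ _))//= [X in _ = _ * (_ * (_ / (X%:R * _)))](bigD1 i)//=.
  have -> : (\prod_(k < b | k != i) (subc (unitc i) l k)`! = \prod_(k < b | k != i) (l k)`!)%N.
    by apply: eq_bigr => k /negPf ki; rewrite !ffunE ki subn0.
  have -> : \prod_(k < b | k != i) p k ^+ subc (unitc i) l k = \prod_(k < b | k != i) p k ^+ l k.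
    by apply: eq_bigr => k /negPf ki; rewrite !ffunE ki subn0.
  rewrite !ffunE eqxx.
  have -> : l i = (l i).-1.+1 by rewrite prednK.
  rewrite subSS subn0 factS exprS !natrM.
  have h1 := fne (l i).-1; have h2 := fne r.
  have h3 : (\prod_(k < b | k != i) (l k)`!)%N%:R != 0 :> R.
    by rewrite pnatr_eq0 -lt0n prodn_gt0// => k; rewrite fact_gt0.
  have h4 : ((l i).-1.+1)%:R != 0 :> R by rewrite pnatr_eq0.
  by field; rewrite h1 h2 h3 nat1r h4.
have pmf_0 : q * multinomial_pmf m p l = m`!%:R * (r%:R * Pr).
  rewrite /multinomial_pmf -/Sl -/q.
  have [Slm'|Slm'] := leqP Sl m; last first.
    have -> : r = 0%N by rewrite /r; lia.
    by rewrite mul0r !mulr0.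
  rewrite /Pr; have -> : r = (m - Sl).+1 by rewrite /r; lia.
  rewrite factS exprS !natrM.
  have h1 := fne (m - Sl)%N; have h2 := Pne l.
  have h4 : ((m - Sl).+1)%:R != 0 :> R by rewrite pnatr_eq0.
  by field; rewrite h1 h2 nat1r h4.
rewrite (eq_bigr _ (fun i _ => pmf_i i)) pmf_0 -mulr_sumr -mulrDr -mulr_suml -mulrDl.
rewrite -natr_sum -natrD -/Sl /r subnKC// mulrA factS natrM.
by rewrite [_.+1%:R * _]mulrC.
Qed.

(** Both sides satisfy the recursion on the number of balls. *)
Lemma mult_exp_indic m p l :
  mult_exp m p (fun j => (j == l)%:R) = multinomial_pmf m p l.
Proof.
elim: m l => [|m IH] l.
  rewrite /= /multinomial_pmf leqn0 sum_nat_eq0.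
  have [<-|l0] := eqVneq (constc 0) l; last first.
    case: forallP => //= H; exfalso; move/eqP: l0; apply; apply/ffunP => i; rewrite ffunE.
    by apply/esym/eqP; have /= := H i.
  case: forallP => [_|[]]; last by move=> i; rewrite ffunE.
  rewrite sub0n expr0 mulr1 fact0 mulr1 [X in X%:R^-1]big1; last by move=> i _; rewrite ffunE.
  by rewrite invr1 mulr1 mul1r big1// => i _; rewrite ffunE expr0.
rewrite /= multinomial_pmfS IH; congr (_ + _); apply: eq_bigr => i _; congr (_ * _).
under eq_mult_exp do rewrite addc_eq unitc_le -mulnb natrM.
by rewrite mult_expZ IH.
Qed.

Section simplex.
Variables (p : 'I_b -> R) (p0 : forall i, 0 <= p i) (p1 : \sum_i p i <= 1).

(** Counts of more than [m] balls in total have probability zero. *)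
Lemma ler_mult_exp m g g' : (forall j, (\sum_k j k <= m)%N -> g j <= g' j) ->
  mult_exp m p g <= mult_exp m p g'.
Proof.
elim: m g g' => [|m IH] g g' gg' /=.
  by apply: gg'; rewrite big1// => i _; rewrite ffunE.
apply: lerD; last first.
  apply: ler_wpM2l; first by rewrite subr_ge0.
  by apply: IH => j jm; apply: gg'; exact: leqW.
apply: ler_sum => i _; apply: ler_wpM2l => //; apply: IH => j jm; apply: gg'.
by rewrite sum_addc sum_unitc addn1.
Qed.

Lemma eq_mult_exp_supp m g g' : (forall j, (\sum_k j k <= m)%N -> g j = g' j) ->
  mult_exp m p g = mult_exp m p g'.
Proof.
by move=> gg'; apply/eqP; rewrite eq_le !ler_mult_exp// => j /gg' ->.
Qed.

Lemma mult_exp_mean m i : mult_exp m p (fun j => (j i)%:R) = m%:R * p i.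
Proof.
elim: m => [|m IH] /=; first by rewrite ffunE mul0r.
under eq_bigr => k _.
  under eq_mult_exp do rewrite ffunE natrD ffunE.
  rewrite mult_expD IH mult_exp_cst mulrDr.
  over.
rewrite big_split/= -mulr_suml (bigD1 i (F := fun k => p k * _))//= eqxx.
rewrite [X in _ + (_ + X)]big1 ?addr0; last first.
  by move=> k ki; rewrite eq_sym (negPf ki) mulr0.
by rewrite IH -natr1 /=; ring.
Qed.

(** The new ball adds to the centred count an independent centred Bernoulli
    variable, of variance [p i * (1 - p i)]. *)
Lemma mult_exp_var m i :
  mult_exp m p (fun j => ((j i)%:R - m%:R * p i) ^+ 2) = m%:R * (p i * (1 - p i)).
Proof.
elim: m => [|m IH] /=; first by rewrite ffunE !mul0r subr0 expr0n.
pose Z j := (j i)%:R - m%:R * p i : R.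
have EZ : mult_exp m p Z = 0.
  by rewrite /Z mult_expD mult_exp_cst mult_exp_mean subrr.
have H (k : R) : mult_exp m p (fun j => (Z j + k) ^+ 2) = m%:R * (p i * (1 - p i)) + k ^+ 2.
  rewrite (@eq_mult_exp _ _ _ (fun j => (Z j ^+ 2 + (2 * k) * Z j) + k ^+ 2)); last first.
    by move=> j; ring.
  by rewrite !mult_expD mult_exp_cst mult_expZ EZ IH mulr0 addr0.
rewrite [X in _ + _ * X](@eq_mult_exp _ _ _ (fun j => (Z j + (- p i)) ^+ 2)); last first.
  by move=> j; rewrite /Z -natr1; ring.
rewrite H.
under eq_bigr => k _.
  rewrite (@eq_mult_exp _ _ _ (fun j => (Z j + ((i == k)%:R - p i)) ^+ 2)); last first.
    by move=> j; rewrite /Z !ffunE natrD -natr1; ring.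
  rewrite H mulrDr.
  over.
rewrite big_split/= -mulr_suml.
rewrite (@eq_bigr _ _ _ _ _ _ (fun k => p k * ((i == k)%:R - p i) ^+ 2)
  (fun k => p k * (p i) ^+ 2 + (i == k)%:R * (p k * (1 - p i *+ 2)))); last first.
  by move=> k _; case: eqP => _; rewrite ?mulr1n ?mulr0n; ring.
rewrite big_split/= -mulr_suml (bigD1 i (F := fun k => (i == k)%:R * _))//= eqxx.
rewrite [X in _ + (_ + (_ + X)) + _]big1 ?addr0; last first.
  by move=> k ki; rewrite eq_sym (negPf ki) mul0r.
by rewrite -natr1 /=; ring.
Qed.

Lemma mult_exp_all m i : mult_exp m p (fun j => (m <= j i)%:R) = p i ^+ m.
Proof.
elim: m => [|m IH] /=; first by rewrite expr0.
rewrite [X in _ + _ * X](@eq_mult_exp_supp _ _ (fun=> 0)); last first.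
  move=> j jm; rewrite ltnNge; case: leqP => //= jim.
  by move: jm; rewrite (bigD1 i)//= leqNgt ltn_addr.
rewrite mult_exp_cst mulr0 addr0 (bigD1 i)//= big1 ?addr0.
  under eq_mult_exp do rewrite !ffunE eqxx addn1 ltnS.
  by rewrite IH exprS.
move=> k ki; rewrite (@eq_mult_exp_supp _ _ (fun=> 0)) ?mult_exp_cst ?mulr0//.
move=> j jm; rewrite !ffunE eq_sym (negPf ki) addn0 ltnNge; case: leqP => //= jim.
by move: jm; rewrite (bigD1 i)//= leqNgt ltn_addr.
Qed.

End simplex.
End multinomial.

(** * Bounded random variables *)
Section bounded_variables.
Context (R : realType) (d : measure_display) (T : measurableType d)
  (P : probability T R).
Implicit Types f g : T -> R.

(** All variables attached to finitely many nodes are of this kind, so that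
    linearity of the integral holds for them without integrability conditions. *)
Definition bounded_var g := measurable_fun setT g /\ exists M, forall x, `|g x| <= M.

Lemma bounded_var_cst (k : R) : bounded_var (fun=> k).
Proof. by split; [exact: measurable_cst|exists `|k|]. Qed.

Lemma bounded_varD f g : bounded_var f -> bounded_var g ->
  bounded_var (fun x => f x + g x).
Proof.
move=> [mf [M fM]] [mg [M' gM']]; split; first exact: measurable_funD.
by exists (M + M') => x; rewrite (le_trans (ler_normD _ _))// lerD.
Qed.

Lemma bounded_varM f g : bounded_var f -> bounded_var g ->
  bounded_var (fun x => f x * g x).
Proof.
move=> [mf [M fM]] [mg [M' gM']]; split; first exact: measurable_funM.
by exists (M * M') => x; rewrite normrM ler_pM.
Qed.

Lemma bounded_var_sum (I : Type) (r : seq I) (F : I -> T -> R) :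
  (forall i, bounded_var (F i)) -> bounded_var (fun x => \sum_(i <- r) F i x).
Proof.
move=> bF; elim: r => [|i r IH].
  by under eq_fun do rewrite big_nil; exact: bounded_var_cst.
by under eq_fun do rewrite big_cons; exact: bounded_varD.
Qed.

Lemma bounded_varX f n : bounded_var f -> bounded_var (fun x => f x ^+ n).
Proof.
move=> bf; elim: n => [|n IH]; first exact: bounded_var_cst.
by under eq_fun do rewrite exprS; exact: bounded_varM.
Qed.

Lemma bounded_var_indic (A : set T) : measurable A -> bounded_var (\1_A).
Proof.
move=> mA; split; first exact: measurable_indic.
by exists 1 => x; rewrite indicE; case: (x \in A) => /=; rewrite ?normr1 ?normr0.
Qed.

Lemma bounded_var_integrable g : bounded_var g -> P.-integrable setT (EFin \o g).
Proof.
move=> [mg [M gM]]; apply: measurable_bounded_integrable => //.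
  exact: le_lt_trans (probability_le1 P measurableT) (ltry _).
exists M; split; first exact: num_real.
by move=> K MK x _; apply: le_trans (gM x) (ltW MK).
Qed.

Lemma bounded_var_EFin g : bounded_var g ->
  (\int[P]_x (g x)%:E)%E = (\int[P]_x g x)%:E.
Proof.
move=> /bounded_var_integrable ig; rewrite /Rintegral fineK//.
exact: integrable_fin_num.
Qed.

Lemma bounded_meanD f g : bounded_var f -> bounded_var g ->
  \int[P]_x (f x + g x) = \int[P]_x f x + \int[P]_x g x.
Proof. by move=> bf bg; apply: RintegralD => //; exact: bounded_var_integrable. Qed.

Lemma bounded_meanZ k g : bounded_var g -> \int[P]_x (k * g x) = k * \int[P]_x g x.
Proof. by move=> bg; apply: RintegralZl => //; exact: bounded_var_integrable. Qed.

Lemma bounded_mean_cst k : \int[P]_x (fun=> k) x = k.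
Proof.
rewrite (@Rintegral_cst _ _ _ P setT measurableT k).
by rewrite /= (_ : fine _ = 1) ?mulr1//; have /= -> := probability_setT P.
Qed.

Lemma bounded_mean_sum (I : Type) (r : seq I) (F : I -> T -> R) :
  (forall i, bounded_var (F i)) ->
  \int[P]_x (\sum_(i <- r) F i x) = \sum_(i <- r) \int[P]_x F i x.
Proof.
move=> bF; elim: r => [|i r IH].
  by under eq_Rintegral do rewrite big_nil; rewrite big_nil bounded_mean_cst.
under eq_Rintegral do rewrite big_cons.
by rewrite bounded_meanD ?IH ?big_cons//; exact: bounded_var_sum.
Qed.

Lemma bounded_mean_indic (A : set T) : measurable A ->
  \int[P]_x (\1_A x) = fine (P A).
Proof. by move=> mA; rewrite /Rintegral integral_indic// setIT. Qed.

Lemma bounded_mean_ae_eq f g : bounded_var f -> bounded_var g ->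
  {ae P, forall x, f x = g x} -> \int[P]_x f x = \int[P]_x g x.
Proof.
move=> [mf _] [mg _] fg; congr fine; apply: ae_eq_integral => //.
- exact/measurable_EFinP.
- exact/measurable_EFinP.
- by apply: filterS fg => x -> _.
Qed.

(** Replacing [g] by the maximum of [f] and [g], which is a.e. equal to [g],
    reduces the claim to a pointwise inequality. *)
Lemma ler_bounded_mean_ae f g : bounded_var f -> bounded_var g ->
  {ae P, forall x, f x <= g x} -> \int[P]_x f x <= \int[P]_x g x.
Proof.
move=> bf bg fg.
have bm : bounded_var (fun x => Num.max (f x) (g x)).
  case: bf bg => [mf [M fM]] [mg [M' gM]]; split; first exact: measurable_maxr.
  exists (Num.max M M') => x; rewrite /Num.max; case: ifP => _.
    by rewrite le_max gM orbT.
  by rewrite le_max fM.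
rewrite (@bounded_mean_ae_eq g (fun x => Num.max (f x) (g x)))//; last first.
  by apply: filterS fg => x ?; rewrite (max_idPr _).
apply: le_Rintegral => //; try exact: bounded_var_integrable.
by move=> x _; rewrite le_max lexx.
Qed.

Lemma ler_bounded_mean f g : bounded_var f -> bounded_var g ->
  (forall x, f x <= g x) -> \int[P]_x f x <= \int[P]_x g x.
Proof. by move=> bf bg fg; apply: ler_bounded_mean_ae => //; exact: aeW. Qed.

Lemma bounded_mean_ge0 g : bounded_var g -> (forall x, 0 <= g x) -> 0 <= \int[P]_x g x.
Proof.
by move=> bg g0; rewrite -[leLHS](bounded_mean_cst 0); apply: ler_bounded_mean => //;
  exact: bounded_var_cst.
Qed.

End bounded_variables.

(** * One split, given the split vector *)
Section offspring.
Context (R : realType) (b s s0 s1 : nat) (hs01 : (b * s1 + s0 <= s.+1)%N).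
Implicit Types (p : 'I_b -> R) (g : {ffun 'I_b -> nat} -> R)
  (l : {ffun 'I_b -> nat}).

(** The conditional expectation of [g] (counts of the children) at a node with
    [a] balls, given the split vector [p]. *)
Definition offspring_exp (a : nat) p g : R :=
  if (a <= s)%N then g (constc b 0)
  else mult_exp (a - s0 - b * s1) p (fun j => g (addc (constc b s1) j)).

Lemma offspring_pmfE a p (l : {ffun 'I_b -> nat}) :
  offspring_pmf s s0 s1 a p l = offspring_exp a p (fun l' => (l' == l)%:R).
Proof.
rewrite /offspring_pmf /offspring_exp; case: ifP => _.
  congr (_%:R); congr nat_of_bool; apply/forallP/eqP => [H|<- i]; last by rewrite ffunE.
  by apply/ffunP => i; rewrite ffunE; apply/esym/eqP.
under eq_mult_exp do rewrite addc_eq -mulnb natrM.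
rewrite mult_expZ mult_exp_indic.
have -> : [forall k, (constc b s1 k <= l k)%N] = [forall i, (s1 <= l i)%N].
  by apply: eq_forallb => i; rewrite ffunE.
case: ifP => _; rewrite ?mul1r ?mul0r//; congr multinomial_pmf; apply/funext => i.
by rewrite !ffunE.
Qed.

Lemma offspring_expZ a p k g : offspring_exp a p (fun l => k * g l) = k * offspring_exp a p g.
Proof. by rewrite /offspring_exp; case: ifP => // _; rewrite mult_expZ. Qed.

Lemma offspring_expD a p g g' :
  offspring_exp a p (fun l => g l + g' l) = offspring_exp a p g + offspring_exp a p g'.
Proof. by rewrite /offspring_exp; case: ifP => // _; rewrite mult_expD. Qed.

Lemma offspring_exp_cst a p k : offspring_exp a p (fun=> k) = k.
Proof. by rewrite /offspring_exp; case: ifP => // _; rewrite mult_exp_cst. Qed.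

Lemma offspring_exp_sum (I : Type) (r : seq I) a p (F : I -> {ffun 'I_b -> nat} -> R) :
  offspring_exp a p (fun l => \sum_(i <- r) F i l) =
  \sum_(i <- r) offspring_exp a p (F i).
Proof.
elim: r => [|i r IH].
  rewrite big_nil -[RHS](offspring_exp_cst a p 0); congr offspring_exp.
  by apply/funext => l; rewrite big_nil.
rewrite big_cons -IH -offspring_expD; congr offspring_exp.
by apply/funext => l; rewrite big_cons.
Qed.

Lemma sum_constc (k : nat) : (\sum_(i < b) constc b k i = b * k)%N.
Proof.
by under eq_bigr do rewrite ffunE; rewrite sum_nat_const card_ord.
Qed.

Section simplex.
Variables (p : 'I_b -> R) (p0 : forall i, 0 <= p i) (p1 : \sum_i p i <= 1).

Lemma ler_offspring_exp a g g' : (forall l, (\sum_k l k <= a)%N -> g l <= g' l) ->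
  offspring_exp a p g <= offspring_exp a p g'.
Proof.
move=> gg'; rewrite /offspring_exp; case: leqP => sa.
  by apply: gg'; rewrite sum_constc muln0.
apply: ler_mult_exp => // j jm; apply: gg'; rewrite sum_addc sum_constc; lia.
Qed.

Lemma simplex_le1 i : p i <= 1.
Proof. by apply: le_trans p1; rewrite (bigD1 i)//= lerDl sumr_ge0. Qed.

(** Chebyshev's inequality in the form used below: the variance of a count is at
    most [m], and [l i] differs from a multinomial count by the constant [s1],
    [a] from [m] by [s0 + b * s1]. The bound is uniform in [p]. *)
Lemma offspring_lln a i : (s < a)%N ->
  offspring_exp a p (fun l => ((l i)%:R / a%:R - p i) ^+ 2) <=
  (2 + 2 * (s0 + b * s1 + s1)%:R ^+ 2) / a%:R.
Proof.
move=> sa; rewrite /offspring_exp leqNgt sa /=.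
set m := (a - s0 - b * s1)%N.
have ma : a = (m + (s0 + b * s1))%N by rewrite /m; lia.
set c : R := (s0 + b * s1 + s1)%:R.
have a0 : 0 < a%:R :> R by rewrite ltr0n (leq_ltn_trans _ sa).
have aR : a%:R = m%:R + (s0 + b * s1)%:R :> R by rewrite {1}ma natrD.
have pi1 := simplex_le1 i; have pi0 := p0 i.
apply: (@le_trans _ _ (mult_exp m p (fun j => a%:R ^- 2 * (2 * ((j i)%:R - m%:R * p i) ^+ 2 + 2 * c ^+ 2)))).
  apply: ler_mult_exp => // j _; rewrite !ffunE.
  have -> : (j i + s1)%:R / a%:R - p i = a%:R^-1 * (((j i)%:R - m%:R * p i) + (s1%:R - (s0 + b * s1)%:R * p i)) :> R.
    have -> : m%:R = a%:R - (s0 + b * s1)%:R :> R by rewrite aR addrK.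
    by rewrite natrD; field; rewrite gt_eqF.
  rewrite exprMn exprVn; apply: ler_wpM2l; first by rewrite invr_ge0 exprn_ge0// ltW.
  set z := (j i)%:R - _; set e := s1%:R - _.
  have ec : e ^+ 2 <= c ^+ 2.
    rewrite -[e ^+ 2]real_normK ?num_real//; rewrite lerXn2r ?nnegrE//.
    have h : (s0 + b * s1)%:R * p i <= (s0 + b * s1)%:R :> R by rewrite ler_piMr.
    have h' : 0 <= (s0 + b * s1)%:R * p i :> R by rewrite mulr_ge0.
    have h'' : (0 : R) <= s1%:R by [].
    by rewrite /e /c natrD ler_norml; apply/andP; split; lra.
  have := sqr_ge0 (z - e); rewrite !expr2 in ec *; nra.
rewrite mult_expZ mult_expD mult_exp_cst (mult_expZ m p 2 (fun j => ((j i)%:R - m%:R * p i) ^+ 2)) mult_exp_var//.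
rewrite mulrC ler_pdivrMr ?exprn_gt0//.
rewrite [a%:R ^+ 2]expr2 [leRHS]mulrA divfK ?gt_eqF//.
have m0 : (0 : R) <= m%:R by [].
have ma' : m%:R <= a%:R :> R by rewrite ler_nat ma leq_addr.
have a1 : 1 <= a%:R :> R by rewrite ler1n (leq_ltn_trans _ sa).
have c0 : 0 <= c ^+ 2 by rewrite sqr_ge0.
have h1 : p i * (1 - p i) <= 1 by nra.
have h0 : 0 <= p i * (1 - p i) by nra.
have h2 : m%:R * (p i * (1 - p i)) <= a%:R by rewrite -[leRHS]mulr1 ler_pM.
rewrite [leRHS]mulrDl; apply: lerD; first by rewrite ler_pM2l.
by rewrite ler_peMr// mulr_ge0.
Qed.

(** A child can receive all [a] balls only if no ball is kept or prescribed and
    the [m = a] multinomial balls fall together, which has probability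
    [p i ^+ m]; and then [m >= 2], because [a > s >= 1]. *)
Lemma offspring_exp_all a : (1 <= s)%N -> (2 <= b)%N -> (s < a)%N ->
  offspring_exp a p (fun l => \sum_i (l i == a)%:R) <= \sum_i p i ^+ 2.
Proof.
move=> hs hb sa; rewrite offspring_exp_sum; apply: ler_sum => i _.
rewrite /offspring_exp leqNgt sa /=; set m := (a - s0 - b * s1)%N.
have [m2|m2] := leqP 2 m.
  apply: (@le_trans _ _ (p i ^+ m)); last first.
    by rewrite -(subnKC m2) exprD ler_piMr ?exprn_ge0// exprn_ile1// simplex_le1.
  rewrite -(mult_exp_all p0 p1); apply: ler_mult_exp => // j jm; rewrite ler_nat.
  rewrite !ffunE; case: eqP => //= E; rewrite lt0b /m.
  by have := leq_pmull s1 (ltnW hb); lia.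
apply: (@le_trans _ _ 0); last by rewrite sqr_ge0.
rewrite -[leRHS](mult_exp_cst m p); apply: ler_mult_exp => // j jm.
rewrite !ffunE; case: eqP => // E.
have jim : (j i <= m)%N by apply: leq_trans jm; rewrite (bigD1 i)//= leq_addr.
exfalso.
have : (b * s1 >= 2 * s1)%N by rewrite leq_mul2r hb orbT.
move: E jim m2; rewrite /m; lia.
Qed.

End simplex.
End offspring.

(** * The mean effect of a split *)
Section kernel.
Context (R : realType) (b s s0 s1 : nat) (hs01 : (b * s1 + s0 <= s.+1)%N)
  (hs : (1 <= s)%N) (hb : (2 <= b)%N)
  (d0 : measure_display) (Om0 : measurableType d0) (P0 : probability Om0 R)
  (V : 'I_b -> {RV P0 >-> R}).
Hypothesis hV : forall x, (forall i, 0 <= V i x) /\ \sum_(i < b) V i x <= 1.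
Implicit Types (g : {ffun 'I_b -> nat} -> R) (l : {ffun 'I_b -> nat}).

Let V0 x i : 0 <= V i x. Proof. by case: (hV x). Qed.
Let VS x : \sum_(i < b) V i x <= 1. Proof. by case: (hV x). Qed.
Let V1 x i : V i x <= 1. Proof. exact: (simplex_le1 (V0 x) (VS x)). Qed.

Lemma bounded_var_split i : bounded_var (V i).
Proof.
split; first exact: measurable_funPT.
by exists 1 => x; rewrite ger0_norm.
Qed.

Lemma bounded_var_mult_exp m g : bounded_var (fun x => mult_exp m (V^~ x) g).
Proof.
elim: m g => [|m IH] g /=; first exact: bounded_var_cst.
apply: bounded_varD.
  by apply: bounded_var_sum => i; apply: bounded_varM => //; exact: bounded_var_split.
apply: bounded_varM => //; apply: bounded_varD; first exact: bounded_var_cst.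
under eq_fun do rewrite -mulN1r; apply: bounded_varM; first exact: bounded_var_cst.
by apply: bounded_var_sum => i; exact: bounded_var_split.
Qed.

Lemma bounded_var_offspring_exp a g :
  bounded_var (fun x => offspring_exp s s0 s1 a (V^~ x) g).
Proof.
rewrite /offspring_exp; case: (a <= s)%N; first exact: bounded_var_cst.
exact: bounded_var_mult_exp.
Qed.

(** The transition operator of the counts from a node to its children. *)
Definition offspring_mean (a : nat) g : R :=
  \int[P0]_x offspring_exp s s0 s1 a (V^~ x) g.

Lemma offspring_mean_leaf a g : (a <= s)%N -> offspring_mean a g = g (constc b 0).
Proof.
by move=> sa; rewrite /offspring_mean /offspring_exp sa; exact: (bounded_mean_cst P0 (g _)).
Qed.

Lemma offspring_mean_cst a k : offspring_mean a (fun=> k) = k.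
Proof.
rewrite /offspring_mean; under eq_Rintegral => x _ do rewrite offspring_exp_cst.
exact: (bounded_mean_cst P0 k).
Qed.

Lemma offspring_meanD a g g' :
  offspring_mean a (fun l => g l + g' l) = offspring_mean a g + offspring_mean a g'.
Proof.
rewrite /offspring_mean; under eq_Rintegral => x _ do rewrite offspring_expD.
by rewrite bounded_meanD//; exact: bounded_var_offspring_exp.
Qed.

Lemma offspring_meanZ a k g : offspring_mean a (fun l => k * g l) = k * offspring_mean a g.
Proof.
rewrite /offspring_mean; under eq_Rintegral => x _ do rewrite offspring_expZ.
by rewrite bounded_meanZ//; exact: bounded_var_offspring_exp.
Qed.

Lemma offspring_mean_sum (I : Type) (r : seq I) a (F : I -> {ffun 'I_b -> nat} -> R) :
  offspring_mean a (fun l => \sum_(i <- r) F i l) =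
  \sum_(i <- r) offspring_mean a (F i).
Proof.
rewrite /offspring_mean; under eq_Rintegral => x _ do rewrite offspring_exp_sum.
by rewrite bounded_mean_sum// => i; exact: bounded_var_offspring_exp.
Qed.

Lemma ler_offspring_mean a g g' : (forall l, (\sum_k l k <= a)%N -> g l <= g' l) ->
  offspring_mean a g <= offspring_mean a g'.
Proof.
move=> gg'; apply: ler_bounded_mean; try exact: bounded_var_offspring_exp.
by move=> x; apply: ler_offspring_exp.
Qed.

Lemma eq_offspring_mean a g g' : (forall l, (\sum_k l k <= a)%N -> g l = g' l) ->
  offspring_mean a g = offspring_mean a g'.
Proof.
by move=> gg'; apply/eqP; rewrite eq_le !ler_offspring_mean// => l /gg' ->.
Qed.

Lemma offspring_mean_le_ae a g k :
  {ae P0, forall x, offspring_exp s s0 s1 a (V^~ x) g <= k} -> offspring_mean a g <= k.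
Proof.
move=> H; rewrite -[leRHS](bounded_mean_cst P0 k); apply: ler_bounded_mean_ae => //.
  exact: bounded_var_offspring_exp.
exact: bounded_var_cst.
Qed.

Lemma split_kernelE a l :
  split_kernel V s s0 s1 a (fun=> setT) l = offspring_mean a (fun l' => (l' == l)%:R).
Proof.
rewrite /split_kernel /offspring_mean.
have -> : [set x : Om0 | forall i : 'I_b, [set: R] (V i x)] = setT by apply/seteqP.
by under eq_Rintegral => x _ do rewrite offspring_pmfE.
Qed.

Lemma split_kernel_ge0 a l : 0 <= split_kernel V s s0 s1 a (fun=> setT) l.
Proof.
rewrite split_kernelE -[leLHS](offspring_mean_cst a 0).
by apply: ler_offspring_mean => l' _; rewrite ler0n.
Qed.

(** The counts in a tree with [n] balls range in a finite type, over which
    expectations are finite sums. *)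
Definition box_counts n (l : {ffun 'I_b -> 'I_n.+1}) : {ffun 'I_b -> nat} :=
  [ffun i => l i : nat].

Lemma box_counts_inj n : injective (@box_counts n).
Proof.
move=> l l' /ffunP H; apply/ffunP => i; apply/val_inj.
by move: (H i); rewrite !ffunE.
Qed.

Lemma sum_split_kernel n a g : (a <= n)%N ->
  \sum_(l : {ffun 'I_b -> 'I_n.+1})
     split_kernel V s s0 s1 a (fun=> setT) (box_counts l) * g (box_counts l)
  = offspring_mean a g.
Proof.
move=> an; under eq_bigr do rewrite split_kernelE mulrC -offspring_meanZ.
rewrite -offspring_mean_sum; apply: eq_offspring_mean => l la.
have ln i : (l i < n.+1)%N.
  by rewrite ltnS (leq_trans _ an)// (leq_trans _ la)// (bigD1 i)//= leq_addr.
pose l' : {ffun 'I_b -> 'I_n.+1} := [ffun i => Ordinal (ln i)].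
have ll' : box_counts l' = l by apply/ffunP => i; rewrite !ffunE.
rewrite (bigD1 l')//= ll' eqxx mulr1 big1 ?addr0// => k kl'.
case: eqP => E; last by rewrite mulr0.
by move/eqP: kl'; case; apply: box_counts_inj; rewrite ll'.
Qed.

Lemma order_stat0_eq1 x : order_stat V 0 x = 1 <-> exists i, V i x = 1.
Proof.
rewrite /order_stat; set sq := [seq V i x | i <- enum 'I_b].
have szq : size sq = b by rewrite size_map size_enum_ord.
have sz : (0 < size (sort >=%R sq))%N by rewrite size_sort szq (ltn_trans _ hb).
have mem0 : nth 0 (sort >=%R sq) 0 \in sq by rewrite -(mem_sort >=%R) mem_nth.
split => [H|[i Vi]].
  by move: mem0; rewrite H => /mapP[i _ ->]; exists i.
have le1 : nth 0 (sort >=%R sq) 0 <= 1 by case/mapP: mem0 => j _ ->.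
have : 1 \in sort >=%R sq.
  by rewrite mem_sort; apply/mapP; exists i; rewrite ?mem_enum.
have : sorted >=%R (sort >=%R sq) by apply: sort_sorted => u v; exact: le_total.
case: (sort >=%R sq) sz le1 => //= h t _ h1 /order_path_min ht.
rewrite inE => /orP[/eqP <-//|t1]; apply/eqP; rewrite eq_le h1/=.
by have /allP /(_ _ t1) := ht (fun u v w uv vw => le_trans vw uv).
Qed.

Section moments.
Hypothesis hV1 : (P0 [set x | order_stat V 0 x = 1%R] < 1)%E.
Variables (beta : R) (beta0 : 0 < beta).
Hypothesis hVbeta : {ae P0, forall x, \sum_(i < b) (V i x) `^ beta = 1}.

Lemma bounded_var_powV (gam : R) : 0 <= gam -> bounded_var (fun x => \sum_(i < b) V i x `^ gam).
Proof.
move=> gam0; apply: bounded_var_sum => i; split.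
  apply: (measurableT_comp (measurable_powR gam)); exact: measurable_funPT.
exists 1 => x; rewrite ger0_norm ?powR_ge0//.
have <- : 1 `^ gam = 1 :> R by rewrite powR1.
by rewrite ge0_ler_powR// nnegrE.
Qed.

(** As [V_i <= 1], [\sum_i V_i^gam <= \sum_i V_i^beta = 1].  Equality in mean
    would force equality almost surely, hence [V_i] in {0, 1} for all [i] and
    some [V_i] equal to 1: this is excluded by the assumption on the largest
    component. *)
Lemma moment_lt1 (gam : R) : beta < gam -> \int[P0]_x (\sum_(i < b) V i x `^ gam) < 1.
Proof.
move=> bg; have g0 : 0 < gam by apply: lt_trans bg.
have bv := bounded_var_powV (ltW g0).
have powle x i : V i x `^ gam <= V i x `^ beta.
  have := V0 x i; rewrite le_eqVlt => /predU1P[<-|Vi].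
    by rewrite !powR0 ?gt_eqF.
  by apply: ger_powR; rewrite ?Vi ?V1// ltW.
have ae_le : {ae P0, forall x, \sum_(i < b) V i x `^ gam <= 1}.
  by apply: filterS hVbeta => x <-; apply: ler_sum.
rewrite lt_neqAle; apply/andP; split; last first.
  rewrite -[leRHS](bounded_mean_cst P0 1); apply: ler_bounded_mean_ae => //.
  exact: bounded_var_cst.
apply/eqP => I1.
have bd : bounded_var (fun x => 1 - \sum_(i < b) V i x `^ gam).
  apply: bounded_varD; first exact: bounded_var_cst.
  under eq_fun do rewrite -mulN1r.
  by apply: bounded_varM => //; exact: bounded_var_cst.
have md := bd.1.
have Iabs : (\int[P0]_x `|(1 - \sum_(i < b) V i x `^ gam)%:E| = 0)%E.
  transitivity (\int[P0]_x (1 - \sum_(i < b) V i x `^ gam)%:E)%E.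
    apply: ae_eq_integral => //.
    - by apply: measurableT_comp => //; exact/measurable_EFinP.
    - exact/measurable_EFinP.
    - by apply: filterS ae_le => x H _ /=; rewrite ger0_norm// subr_ge0.
  rewrite bounded_var_EFin// bounded_meanD; last 2 first.
  - exact: bounded_var_cst.
  - under eq_fun do rewrite -mulN1r.
    by apply: bounded_varM => //; exact: bounded_var_cst.
  rewrite (bounded_mean_cst P0 1); under eq_Rintegral => x _ do rewrite -mulN1r.
  by rewrite bounded_meanZ// I1 mulN1r subrr.
have {Iabs} : ae_eq P0 setT (fun x => (1 - \sum_(i < b) V i x `^ gam)%:E) (cst 0%E).
  by apply/ae_eq_integral_abs => //; exact/measurable_EFinP.
move=> ae0.
have ae1 : {ae P0, forall x, exists i, V i x = 1}.
  apply: filterS2 hVbeta ae0 => x Hb /(_ I) /= [] /eqP; rewrite subr_eq0 => /eqP Hg.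
  apply: contrapT => nV.
  have lt i : 0 < V i x -> V i x `^ gam < V i x `^ beta.
    move=> Vi; rewrite /powR gt_eqF// ltr_expR ltr_nM2r//.
    apply: ln_lt0; rewrite Vi /= lt_neqAle V1 andbT.
    by apply/eqP => E; apply: nV; exists i.
  have [i Vi] : exists i, 0 < V i x.
    apply: contrapT => nP; move: Hb; rewrite big1; last first.
      move=> i _; have := V0 x i; rewrite le_eqVlt => /predU1P[<-|Vi].
        by rewrite powR0// gt_eqF.
      by exfalso; apply: nP; exists i.
    by move/eqP; rewrite eq_sym oner_eq0.
  move: (eqxx (1 : R)); rewrite {1}Hg -Hb (bigD1 i)//= [X in _ == X](bigD1 i)//=.
  by rewrite lt_eqF// ltr_leD ?lt//; apply: ler_sum.
have mS : measurable [set x | order_stat V 0 x = 1].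
  have -> : [set x | order_stat V 0 x = 1] = \bigcup_(i in [set: 'I_b]) (V i @^-1` [set 1]).
    by apply/seteqP; split => x /=; [move/order_stat0_eq1 => [i ?]; exists i|
      case=> i _ ?; apply/order_stat0_eq1; exists i].
  by apply: fin_bigcup_measurable => // i _; exact: measurable_funPTI.
suff : P0 [set x | order_stat V 0 x = 1] = 1%E by move=> H; move: hV1; rewrite H ltxx.
have {}ae1 : {ae P0, forall x, order_stat V 0 x = 1}.
  by apply: filterS ae1 => x /order_stat0_eq1.
have /negligibleP : P0.-negligible (~` [set x | order_stat V 0 x = 1]) by exact: ae1.
move=> /(_ (measurableC mS)) H.
have := probability_setC P0 (measurableC mS).
by rewrite setCK H sube0.
Qed.

Hypothesis beta1 : beta <= 1.

(** The recursion at count [a] refers to the value at [a] itself, with this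
    weight; it can be solved because the weight is less than one. *)
Lemma offspring_mean_all_lt1 a : (s < a)%N ->
  offspring_mean a (fun l => \sum_i (l i == a)%:R) < 1.
Proof.
move=> sa; have b2 : beta < 2 by apply: le_lt_trans beta1 _; rewrite ltr1n.
apply: le_lt_trans (moment_lt1 b2).
apply: ler_bounded_mean; [exact: bounded_var_offspring_exp|exact: bounded_var_powV|].
move=> x; apply: le_trans (offspring_exp_all hs01 (V0 x) (VS x) hs hb sa) _.
by apply: ler_sum => i _; rewrite powR_mulrn.
Qed.

End moments.
End kernel.

(** * Powers with log-periodic coefficients *)
Section modulus.
Variable R : realType.

Lemma exp_le0_lipschitz (u v : R) : u <= 0 -> v <= 0 -> `|expR u - expR v| <= `|u - v|.
Proof.
wlog uv : u v / u <= v => [H|] u0 v0.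
  have [|/ltW] := leP u v; first by move=> uv; exact: H.
  by move=> vu; rewrite distrC [leRHS]distrC; exact: H.
have e1 : expR v <= 1 by rewrite -expR0 ler_expR.
have := expR_ge1Dx (u - v); rewrite expRD expRN => h.
have ev := expR_gt0 v.
have h2 : expR u = expR u / expR v * expR v by rewrite divfK ?gt_eqF.
have le_uv : expR u <= expR v by rewrite ler_expR.
rewrite !ler0_norm ?subr_le0//.
have h3 : expR v * (1 + (u - v)) <= expR u by rewrite [leRHS]h2 mulrC ler_wpM2r// ltW.
nra.
Qed.

Lemma ln_lipschitz (e x y : R) : 0 < e -> e <= x -> e <= y -> `|ln x - ln y| <= `|x - y| / e.
Proof.
move=> e0; wlog xy : x y / x <= y => [H|] ex ey.
  have [|/ltW] := leP x y; first by move=> xy; exact: H.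
  by move=> yx; rewrite distrC [`|x - y|]distrC; exact: H.
have x0 : 0 < x by apply: lt_le_trans ex.
have y0 : 0 < y by apply: lt_le_trans ey.
rewrite !ler0_norm ?subr_le0// ?ler_ln ?posrE// !opprB -ln_div ?posrE//.
have -> : y / x = 1 + (y - x) / x by field; rewrite gt_eqF.
apply: le_trans (le_ln1Dx _) _.
  by apply: lt_le_trans (_ : 0 <= _); rewrite ?ltrN10// divr_ge0 ?subr_ge0// ltW.
by rewrite ler_wpM2l ?subr_ge0// lef_pV2 ?posrE.
Qed.

(** A modulus of continuity of [y |-> w (t + ln y) y^beta] on [0, 1], uniform in
    [t].  Its form [e + K (x - y)^2] turns a bound on the second moment of
    [x - y] into a bound on the mean of the increment.  Near 0 the function is
    small because of the power; away from 0 the logarithm is Lipschitz; and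
    points at distance at least [rho] are covered by the quadratic term. *)
Lemma log_periodic_modulus (w : R -> R) (B beta : R) : 0 < beta ->
  (forall x, `|w x| <= B) ->
  (forall e, 0 < e -> exists2 dl, 0 < dl & forall x y, `|x - y| < dl -> `|w x - w y| <= e) ->
  forall e, 0 < e -> exists2 K, 0 <= K &
    forall t x y, 0 <= x <= 1 -> 0 <= y <= 1 ->
      `|w (t + ln x) * x `^ beta - w (t + ln y) * y `^ beta| <= e + K * (x - y) ^+ 2.
Proof.
move=> beta0 wB' wu e e0.
pose B' := `|B| + 1.
have B0 : 0 < B' by rewrite ltr_pwDr.
have wB x : `|w x| <= B' by apply: le_trans (wB' x) _; rewrite ler_wpDr// ler_norm.
have e20 : 0 < e / 2 by rewrite divr_gt0.
have [d1 d10 Hd1] := wu _ e20.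
(* below [eta] the function is at most [e / 2] in absolute value *)
pose eta := (e / 2 / B') `^ beta^-1.
have eta0 : 0 < eta by rewrite powR_gt0 // divr_gt0.
have etab : B' * eta `^ beta = e / 2.
  by rewrite /eta -powRrM mulVf ?gt_eqF// powRr1 ?divr_ge0 ?ltW// mulrC divfK ?gt_eqF.
pose d2 := Num.min d1 (e / (2 * B' * beta)).
have d20 : 0 < d2 by rewrite lt_min d10 /= divr_gt0// !mulr_gt0.
pose rho := Num.min d2 1 * (eta / 2).
have rho0 : 0 < rho by rewrite mulr_gt0 ?divr_gt0// lt_min d20 ltr01.
have powle1 (x : R) : 0 <= x <= 1 -> x `^ beta <= 1.
  move=> /andP[x0 x1]; have <- : 1 `^ beta = 1 :> R by rewrite powR1.
  by rewrite ge0_ler_powR ?nnegrE// ltW.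
have hB t (x : R) : `|w (t + ln x) * x `^ beta| <= B' * x `^ beta.
  by rewrite normrM [`|_ `^ _|]ger0_norm ?powR_ge0// ler_wpM2r ?powR_ge0.
exists (2 * B' / rho ^+ 2); first by rewrite divr_ge0 ?sqr_ge0// mulr_ge0// ltW.
move=> t x y x01 y01.
have [rxy|xyr] := leP rho `|x - y|.
  apply: (@le_trans _ _ (2 * B')).
    apply: le_trans (ler_normB _ _) _; rewrite mulr_natl mulr2n lerD//.
      by apply: le_trans (hB _ _) _; rewrite ler_piMr ?powle1// ltW.
    by apply: le_trans (hB _ _) _; rewrite ler_piMr ?powle1// ltW.
  apply: ler_wpDl; first exact: ltW.
  rewrite -[leRHS]mulrA ler_peMr//; first by rewrite mulr_ge0// ltW.
  rewrite mulrC ler_pdivlMr ?exprn_gt0// mul1r -[leRHS]real_normK ?num_real//.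
  by rewrite lerXn2r ?nnegrE// ltW.
apply: (@le_trans _ _ e); last first.
  by rewrite ler_wpDr// mulr_ge0 ?sqr_ge0// divr_ge0 ?sqr_ge0// mulr_ge0// ltW.
have eta20 : 0 <= eta / 2 by rewrite divr_ge0// ltW.
have rho_eta : rho <= eta / 2 by rewrite /rho ler_piMl// ge_min lexx orbT.
have [/andP[xe ye]|] := boolP ((eta / 2 <= x) && (eta / 2 <= y)).
  have x0 : 0 < x by apply: lt_le_trans xe; rewrite divr_gt0.
  have y0 : 0 < y by apply: lt_le_trans ye; rewrite divr_gt0.
  have lnd : `|ln x - ln y| < d2.
    apply: le_lt_trans (ln_lipschitz _ xe ye) _; first by rewrite divr_gt0.
    rewrite ltr_pdivrMr ?divr_gt0//; apply: lt_le_trans xyr _.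
    by rewrite /rho ler_wpM2r// ge_min lexx.
  have -> : w (t + ln x) * x `^ beta - w (t + ln y) * y `^ beta =
     (w (t + ln x) - w (t + ln y)) * x `^ beta + w (t + ln y) * (x `^ beta - y `^ beta) by ring.
  apply: le_trans (ler_normD _ _) _; rewrite [e]splitr lerD//.
    rewrite normrM -[leRHS]mulr1 ler_pM//; last first.
      by rewrite ger0_norm ?powR_ge0// powle1.
    apply: Hd1; rewrite (_ : t + ln x - (t + ln y) = ln x - ln y); last by ring.
    by apply: lt_le_trans lnd _; rewrite ge_min lexx.
  rewrite normrM; apply: le_trans (_ : B' * (beta * d2) <= _).
    rewrite ler_pM//; rewrite /powR !gt_eqF//.
    apply: le_trans (exp_le0_lipschitz _ _) _.
    - by apply: mulr_ge0_le0; [exact: ltW|apply: ln_le0; case/andP: x01].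
    - by apply: mulr_ge0_le0; [exact: ltW|apply: ln_le0; case/andP: y01].
    by rewrite -mulrBr normrM gtr0_norm// ler_wpM2l// ltW.
  apply: le_trans (_ : B' * (beta * (e / (2 * B' * beta))) <= _).
    by rewrite ler_pM2l// ler_pM2l// ge_min lexx orbT.
  by rewrite le_eqVlt; apply/orP; left; apply/eqP; field; rewrite !gt_eqF.
rewrite negb_and -!ltNge => small.
have [xeta yeta] : x <= eta /\ y <= eta.
  move: xyr; rewrite ltr_norml => /andP[h1 h2].
  by case/orP: small => h; split; lra.
case/andP: x01 => x0 _; case/andP: y01 => y0 _.
apply: le_trans (ler_normB _ _) _; rewrite [e]splitr lerD//.
  by apply: le_trans (hB _ _) _; rewrite -etab ler_pM2l// ge0_ler_powR ?nnegrE// ltW.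
by apply: le_trans (hB _ _) _; rewrite -etab ler_pM2l// ge0_ler_powR ?nnegrE// ltW.
Qed.

Lemma power_modulus (gam : R) : 0 < gam ->
  forall e, 0 < e -> exists2 K, 0 <= K &
    forall x y, 0 <= x <= 1 -> 0 <= y <= 1 ->
      `|x `^ gam - y `^ gam| <= e + K * (x - y) ^+ 2.
Proof.
move=> g0 e e0.
have [||K K0 H] := @log_periodic_modulus (cst 1) 1 gam g0 _ _ e e0.
- by move=> x; rewrite normr1.
- by move=> e' e'0; exists 1 => // x y _; rewrite subrr normr0 ltW.
exists K => // x y x01 y01.
by have := H 0 x y x01 y01; rewrite /= !mul1r.
Qed.

End modulus.

(** * Superharmonic functions of the counts *)
Section kernel_growth.
Context (R : realType) (b s s0 s1 : nat) (hs01 : (b * s1 + s0 <= s.+1)%N)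
  (hs : (1 <= s)%N) (hb : (2 <= b)%N)
  (d0 : measure_display) (Om0 : measurableType d0) (P0 : probability Om0 R)
  (V : 'I_b -> {RV P0 >-> R}).
Hypothesis hV : forall x, (forall i, 0 <= V i x) /\ \sum_(i < b) V i x <= 1.
Hypothesis hV1 : (P0 [set x | order_stat V 0 x = 1%R] < 1)%E.
Variables (beta : R) (beta0 : 0 < beta) (beta1 : beta <= 1).
Hypothesis hVbeta : {ae P0, forall x, \sum_(i < b) (V i x) `^ beta = 1}.
Implicit Types (g : {ffun 'I_b -> nat} -> R) (l : {ffun 'I_b -> nat}).
Local Notation Q := (offspring_mean s s0 s1 V).

Lemma proportion_itv01 l a (i : 'I_b) : (0 < a)%N -> (\sum_k l k <= a)%N -> 0 <= ((l i)%:R / a%:R : R) <= 1.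
Proof.
move=> a0 la; rewrite divr_ge0//= ler_pdivrMr ?ltr0n// mul1r ler_nat.
by rewrite (leq_trans _ la)// (bigD1 i)//= leq_addr.
Qed.

(** The proportions [l i / a] may be replaced by the [p i], by [power_modulus]
    and [offspring_lln]. *)
Lemma offspring_power_exp (gam e : R) : 0 < gam -> 0 < e ->
  exists A : nat, (s < A)%N /\ forall a (p : 'I_b -> R), (A <= a)%N ->
    (forall i, 0 <= p i) -> \sum_i p i <= 1 ->
    offspring_exp s s0 s1 a p (fun l => \sum_i ((l i)%:R / a%:R) `^ gam) <= \sum_i p i `^ gam + e.
Proof.
move=> g0 e0; have b0 : 0 < b%:R :> R by rewrite ltr0n (ltn_trans _ hb).
have e'0 : 0 < e / 2 / b%:R by rewrite !divr_gt0.
have [K K0 HK] := power_modulus g0 e'0.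
pose c : R := 2 + 2 * (s0 + b * s1 + s1)%:R ^+ 2.
have c0 : 0 <= c by rewrite addr_ge0// mulr_ge0// sqr_ge0.
pose M := K * c / (e / 2 / b%:R).
exists (maxn s.+1 (Num.bound M)); split; first by rewrite leq_max leqnn.
move=> a p; rewrite geq_max => /andP[sa Ma] p0 p1.
have a0 : (0 < a)%N by apply: leq_ltn_trans sa.
have aR : 0 < a%:R :> R by rewrite ltr0n.
have MR : M <= a%:R.
  apply: le_trans (ler_norm _) _; apply: le_trans (ltW (archi_boundP (normr_ge0 _))) _.
  by rewrite ler_nat; apply: leq_trans Ma; rewrite /M ger0_norm// divr_ge0 ?mulr_ge0// ltW.
have {}MR : K * (c / a%:R) <= e / 2 / b%:R.
  by rewrite mulrA ler_pdivrMr// [leRHS]mulrC -ler_pdivrMr.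
rewrite offspring_exp_sum.
apply: le_trans (_ : \sum_i (p i `^ gam + (e / b%:R)) <= _); last first.
  by rewrite big_split/= lerD2l sumr_const card_ord -[leLHS]mulr_natr divfK ?gt_eqF.
apply: ler_sum => i _.
apply: le_trans (_ : offspring_exp s s0 s1 a p (fun l => (p i `^ gam + e / 2 / b%:R) + K * ((l i)%:R / a%:R - p i) ^+ 2) <= _).
  apply: ler_offspring_exp => // l la.
  have p01 : 0 <= p i <= 1 by rewrite p0 (simplex_le1 p0 p1).
  have := HK _ _ (proportion_itv01 i a0 la) p01.
  by move/(le_trans (ler_norm _)); rewrite lerBlDl addrA.
rewrite offspring_expD offspring_exp_cst offspring_expZ.
have -> : e / b%:R = e / 2 / b%:R + e / 2 / b%:R by field; rewrite gt_eqF.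
rewrite -addrA !lerD2l; apply: le_trans MR; rewrite ler_wpM2l//.
exact: offspring_lln.
Qed.

Lemma offspring_power_contraction (gam : R) : beta < gam ->
  exists kap : R, kap < 1 /\ exists A : nat, forall a, (A <= a)%N ->
    Q a (fun l => \sum_i (l i)%:R `^ gam) <= kap * a%:R `^ gam.
Proof.
move=> bg; have g0 : 0 < gam by apply: lt_trans bg.
have k1 := moment_lt1 hb hV hV1 beta0 hVbeta bg.
set k0 := Rintegral _ _ _ in k1.
have e0 : 0 < (1 - k0) / 2 by rewrite divr_gt0// subr_gt0.
have [A [sA HA]] := offspring_power_exp g0 e0.
exists (k0 + (1 - k0) / 2); split; first by lra.
exists A => a Aa; have a0 : (0 < a)%N by apply: leq_trans Aa; apply: leq_ltn_trans sA.
have aR : 0 < a%:R :> R by rewrite ltr0n.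
rewrite (@eq_offspring_mean _ _ _ _ _ hs01 _ _ _ _ hV _ _
   (fun l => a%:R `^ gam * \sum_i ((l i)%:R / a%:R) `^ gam)); last first.
  move=> l _; rewrite mulr_sumr; apply: eq_bigr => i _.
  by rewrite -powRM ?divr_ge0// ?ltW// mulrC divfK ?gt_eqF.
rewrite offspring_meanZ// mulrC ler_wpM2r ?powR_ge0//.
apply: (@le_trans _ _ (\int[P0]_x (\sum_(i < b) V i x `^ gam + (1 - k0) / 2))).
  apply: ler_bounded_mean.
  - exact: bounded_var_offspring_exp.
  - apply: bounded_varD; last exact: bounded_var_cst.
    by apply: bounded_var_powV => //; exact: ltW.
  - by move=> x; have [V0 VS] := hV x; apply: HA.
rewrite bounded_meanD; last 2 first.
- by apply: bounded_var_powV => //; exact: ltW.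
- exact: bounded_var_cst.
by rewrite (bounded_mean_cst P0 ((1 - k0) / 2)).
Qed.

Lemma offspring_mean_empty (u : nat -> R) : u 0%N = 0 -> Q 0 (fun l => \sum_i u (l i)) = 0.
Proof. by move=> u0; rewrite offspring_mean_leaf// big1// => i _; rewrite ffunE. Qed.

(** The Poisson equation of the counts.  A child never has more balls than its
    parent, so the value at [K.+1] is determined by the values up to [K], once
    the weight of the case of a child with all [K.+1] balls is moved to the
    left hand side; that weight is less than one by [offspring_mean_all_lt1]. *)
Lemma offspring_poisson (t : nat -> R) (K : nat) : t 0%N = 0 ->
  exists u : nat -> R, [/\ u 0%N = 0,
    forall a, (a <= K)%N -> u a = t a + Q a (fun l => \sum_i u (l i))
    & (forall a, 0 <= t a) -> forall a, 0 <= u a].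
Proof.
move=> t0; elim: K => [|K [u [u0 uK uge]]].
  exists (fun=> 0); split=> // a; rewrite leqn0 => /eqP ->.
  by rewrite (@offspring_mean_empty (fun=> 0))// t0 addr0.
set a := K.+1.
pose p := Q a (fun l => \sum_i (l i == a)%:R).
have p1 : p < 1.
  have [as_|sa] := leqP a s; last exact: (offspring_mean_all_lt1 hs01 hs hb hV hV1 beta0 hVbeta beta1 sa).
  by rewrite /p offspring_mean_leaf// big1// => i _; rewrite ffunE.
pose rest := Q a (fun l => \sum_i (if l i == a then 0 else u (l i))).
pose c := (t a + rest) / (1 - p).
pose u' x := if x == a then c else u x.
exists u'; split => //.
- move=> a'; rewrite leq_eqVlt => /predU1P[->|a'K]; last first.
    have a'K' : (a' <= K)%N by [].
    rewrite {1}/u' ltn_eqF// uK//; congr (_ + _); apply: eq_offspring_mean => // l la.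
    apply: eq_bigr => i _; rewrite /u' ltn_eqF// ltnS (leq_trans _ a'K')//.
    by rewrite (leq_trans _ la)// (bigD1 i)//= leq_addr.
  rewrite {1}/u' eqxx.
  rewrite (@eq_offspring_mean _ _ _ _ _ hs01 _ _ _ _ hV _ _
     (fun l => c * (\sum_i (l i == a)%:R) + \sum_i (if l i == a then 0 else u (l i)))); last first.
    move=> l _; rewrite mulr_sumr -big_split; apply: eq_bigr => i _ /=.
    by rewrite /u'; case: eqP => _; rewrite ?mulr1 ?mulr0 ?addr0 ?add0r.
  rewrite offspring_meanD// offspring_meanZ// -/p -/rest.
  have cE : c * (1 - p) = t a + rest by rewrite /c divfK// gt_eqF// subr_gt0.
  by move: cE; rewrite mulrBr mulr1 => /eqP; rewrite subr_eq => /eqP {1}->; ring.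
- move=> tge x; rewrite /u'; case: eqP => _; last exact: uge.
  apply: divr_ge0; last by rewrite subr_ge0 ltW.
  rewrite addr_ge0//.
  rewrite /rest -[leLHS](offspring_mean_cst s s0 s1 V a 0); apply: ler_offspring_mean => // l _ /=.
  by apply: sumr_ge0 => i _; case: ifP => // _; exact: uge.
Qed.

Lemma powR_ge1 (gam : R) a : 0 < gam -> (0 < a)%N -> 1 <= a%:R `^ gam :> R.
Proof.
by move=> g0 a0; rewrite -[leLHS](powRr0 a%:R) ler_powR ?ler1n// ltW.
Qed.

(** [psi a] dominates the expected number of nonempty nodes below a node with
    [a] balls.  Up to some [A] it is the exact solution of the recursion;
    beyond [A] it is [C a^gam], which gains [C (1 - kap) a^gam >= 1] at each
    split. *)
Lemma size_bound (gam : R) : beta < gam ->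
  exists psi C : _, [/\ 0 <= C, forall a : nat, 0 <= psi a <= C * a%:R `^ gam
    & forall a, (0 < a)%N%:R + Q a (fun l => \sum_i psi (l i)) <= psi a].
Proof.
move=> bg; have g0 : 0 < gam by apply: lt_trans bg.
have [kap [k1 [A HA]]] := offspring_power_contraction bg.
have [|u [u0 uA uge]] := @offspring_poisson (fun a => (0 < a)%N%:R) A; first by [].
have {}uge : forall a, 0 <= u a by apply: uge => a; rewrite ler0n.
pose C := \sum_(a < A.+1) u a + (1 - kap)^-1.
have k1' : 0 < 1 - kap by rewrite subr_gt0.
have C0 : 0 <= C by rewrite addr_ge0 ?invr_ge0 ?sumr_ge0// ltW.
have uC a : (a <= A)%N -> u a <= C.
  move=> aA; rewrite /C (bigD1 (Ordinal (aA : a < A.+1)%N))//= -addrA lerDl.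
  by rewrite addr_ge0 ?invr_ge0 ?sumr_ge0// ltW.
pose psi a := if (a <= A)%N then u a else C * a%:R `^ gam.
have psiC a : 0 <= psi a <= C * a%:R `^ gam.
  rewrite /psi; case: leqP => aA; last by rewrite mulr_ge0 ?powR_ge0/=.
  rewrite uge/=; case: a aA => [_|a aA]; first by rewrite u0 mulr_ge0 ?powR_ge0.
  by apply: le_trans (uC _ aA) _; rewrite ler_peMr// powR_ge1.
exists psi, C; split => // a; rewrite {2}/psi; case: (leqP a A) => aA.
  rewrite uA// lerD2l; apply: ler_offspring_mean => // l la.
  apply: ler_sum => i _; rewrite /psi ifT// (leq_trans _ aA)//.
  by rewrite (leq_trans _ la)// (bigD1 i)//= leq_addr.
have a0 : (0 < a)%N by apply: leq_ltn_trans aA.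
rewrite a0; apply: (@le_trans _ _ (1 + C * (kap * a%:R `^ gam))).
  rewrite lerD2l; apply: le_trans (_ : C * Q a (fun l => \sum_i (l i)%:R `^ gam) <= _).
    rewrite -offspring_meanZ//; apply: ler_offspring_mean => // l _.
    by rewrite mulr_sumr; apply: ler_sum => i _; case/andP: (psiC (l i)).
  by rewrite ler_wpM2l// HA// ltnW.
have C1 : 1 <= C * (1 - kap).
  by rewrite -ler_pdivrMr// div1r /C lerDr sumr_ge0.
have a1 := powR_ge1 g0 a0.
nra.
Qed.

End kernel_growth.

(** * The branching property *)
Section finite_valued.
Context (R : realType) (d : measure_display) (Om : measurableType d)
  (P : probability Om R) (T : finType) (Y : Om -> T).
Hypothesis mY : forall t, measurable (Y @^-1` [set t]).

Lemma bounded_var_fin (g : T -> R) : bounded_var (fun x => g (Y x)).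
Proof.
have -> : (fun x => g (Y x)) = (fun x => \sum_t g t * \1_(Y @^-1` [set t]) x).
  apply/funext => x; rewrite (bigD1 (Y x))//= big1 ?addr0.
    by rewrite indicE mem_set// mulr1.
  by move=> t tY; rewrite indicE memNset ?mulr0//= => E; rewrite E eqxx in tY.
apply: bounded_var_sum => t; apply: bounded_varM; first exact: bounded_var_cst.
exact: bounded_var_indic.
Qed.

End finite_valued.

Section process.
Context (R : realType) (b s s0 s1 : nat) (hs01 : (b * s1 + s0 <= s.+1)%N)
  (d0 : measure_display) (Om0 : measurableType d0) (P0 : probability Om0 R)
  (V : 'I_b -> {RV P0 >-> R}).
Hypothesis hV : forall x, (forall i, 0 <= V i x) /\ \sum_(i < b) V i x <= 1.
Context (d : measure_display) (Om : measurableType d) (P : probability Om R)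
  (W : node b -> 'I_b -> {RV P >-> R}) (N : node b -> {RV P >-> nat}) (n : nat).
Hypothesis hT : is_split_tree V W N s s0 s1 n.
Implicit Types (g : {ffun 'I_b -> nat} -> R) (l : {ffun 'I_b -> nat}) (u v : node b).
Local Notation Q := (offspring_mean s s0 s1 V).
Local Notation q a l := (split_kernel V s s0 s1 a (fun=> setT) l).
Local Notation box := {ffun 'I_b -> 'I_n.+1}.

Let hist m : set (set Om) := <<s history_gen W N m >>.

Lemma history_setI m A B : hist m A -> hist m B -> hist m (A `&` B).
Proof. exact: (@measurableI _ (g_sigma_algebraType (history_gen W N m))). Qed.

Lemma history_count m u (D : set nat) : (size u <= m)%N -> hist m (N u @^-1` D).
Proof.
move=> um; have -> : N u @^-1` D = \bigcup_(j in D) (N u @^-1` [set j]).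
  by apply/seteqP; split => x /=; [exists (N u x)|case=> j Dj ->].
apply: (@bigcup_measurable _ (g_sigma_algebraType (history_gen W N m))) => j _.
by apply: sub_gen_smallest; left; exists u, j.
Qed.

Lemma history_bigcap m (I : finType) (F : I -> set Om) :
  (forall i, hist m (F i)) -> hist m [set x | forall i, F i x].
Proof.
move=> mF; have -> : [set x | forall i, F i x] = \bigcap_(i in [set: I]) F i.
  by apply/seteqP; split => x /= H i; [move=> _; exact: H|exact: H].
apply: (@fin_bigcap_measurable _ (g_sigma_algebraType (history_gen W N m))) => //.
by move=> i _; exact: mF.
Qed.

Lemma measurable_count u (D : set nat) : measurable (N u @^-1` D).
Proof. exact: measurable_funPTI. Qed.

Lemma measurable_history m A : hist m A -> measurable A.
Proof.
apply: smallest_sub; first exact: sigma_algebra_measurable.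
move=> B [[u [j [_ ->]]]|[u [i [D [_ mD ->]]]]].
  exact: measurable_count.
exact: measurable_funPTI.
Qed.

Definition raw_children v x : {ffun 'I_b -> nat} := [ffun i => N (rcons v i) x].

Lemma measurable_raw_children v l : measurable [set x | raw_children v x = l].
Proof.
have -> : [set x | raw_children v x = l] =
    \bigcap_(i in [set: 'I_b]) (N (rcons v i) @^-1` [set l i]).
  apply/seteqP; split => x /=; first by move=> <- i _ /=; rewrite ffunE.
  by move=> H; apply/ffunP => i; rewrite ffunE; exact: H.
by apply: fin_bigcap_measurable => // i _; exact: measurable_count.
Qed.

Lemma split_kernel_le1 a l : q a l <= 1.
Proof.
rewrite split_kernelE -[leRHS](offspring_mean_cst s s0 s1 V a 1).
by apply: ler_offspring_mean => // l' _; case: (_ == _).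
Qed.

Lemma bounded_var_split_kernel v l : bounded_var (fun x => q (N v x) l).
Proof.
split.
  apply: (@measurableT_comp _ _ _ _ _ _ (fun a => q a l)) => //.
by exists 1 => x; rewrite ger0_norm ?split_kernel_le1 ?split_kernel_ge0.
Qed.

Lemma bounded_var_prod (I : Type) (r : seq I) (F : I -> Om -> R) :
  (forall i, bounded_var (F i)) -> bounded_var (fun x => \prod_(i <- r) F i x).
Proof.
move=> bF; elim: r => [|i r IH].
  by under eq_fun do rewrite big_nil; exact: bounded_var_cst.
by under eq_fun do rewrite big_cons; exact: bounded_varM.
Qed.

(** The branching property with full boxes for the split vectors: only the
    counts matter from here on. *)
Lemma branching_counts m A (k : m.-tuple 'I_b -> {ffun 'I_b -> nat}) : hist m A ->
  \int[P]_x (\1_A x * \prod_(v : m.-tuple 'I_b) (raw_children v x == k v)%:R) =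
  \int[P]_x (\1_A x * \prod_(v : m.-tuple 'I_b) q (N v x) (k v)).
Proof.
move=> hA; have mA := measurable_history hA.
have [_ _ /(_ m A hA (fun _ _ => setT) (fun t i => k t i) (fun _ _ => measurableT))] := hT.
set S := [set x | _] => PE.
have mS : measurable S.
  have -> : S = \bigcap_(t in [set: m.-tuple 'I_b]) [set x | raw_children t x = k t].
    apply/seteqP; split => x /= H v; first by move=> _; apply/ffunP => i; rewrite ffunE; exact: (H v i).2.
    by move=> i; split=> //; have /= /ffunP/(_ i) := H v I; rewrite ffunE.
  by apply: fin_bigcap_measurable => // v _; exact: measurable_raw_children.
transitivity (fine (P (A `&` S))).
  rewrite -bounded_mean_indic; last exact: measurableI.
  apply: eq_Rintegral => x _; rewrite indicI; congr (_ * _).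
  rewrite indicE; case: (boolP (x \in S)) => xS.
    rewrite big1// => v _; have -> : raw_children v x = k v; last by rewrite eqxx.
    by apply/ffunP => i; rewrite ffunE; move/set_mem: xS => /(_ v i)[].
  have [v Hv] : exists v : m.-tuple 'I_b, raw_children v x != k v.
    apply: contrapT => H; move/negP: xS; apply; apply/mem_set => v i; split=> //.
    have : raw_children v x = k v.
      by apply/eqP; apply: contrapT => /negP H'; apply: H; exists v.
    by move/ffunP/(_ i); rewrite ffunE.
  by rewrite (bigD1 v)//= (negPf Hv) mul0r.
rewrite PE integral_mkcond; congr fine; apply: eq_integral => x _.
rewrite patchE indicE; case: ifP => _; last by rewrite mul0r.
by rewrite mul1r.
Qed.

Lemma bounded_var_raw_children v l : bounded_var (fun x => (raw_children v x == l)%:R : R).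
Proof.
have -> : (fun x => (raw_children v x == l)%:R : R) = \1_[set x | raw_children v x = l].
  apply/funext => x; rewrite indicE; congr (_%:R); congr nat_of_bool.
  by apply/eqP/idP => [/mem_set|/set_mem].
exact/bounded_var_indic/measurable_raw_children.
Qed.

(** Weights on the children of the nodes of generation [m] factorize: expand the
    product of sums over the families of counts, on each of which
    [branching_counts] applies.  Taking most weights equal to 1 gives all
    marginal laws. *)
Lemma branching_box m A (G : m.-tuple 'I_b -> {ffun 'I_b -> nat} -> R) : hist m A ->
  \int[P]_x (\1_A x * \prod_(v : m.-tuple 'I_b) \sum_(l : box) (raw_children v x == box_counts l)%:R * G v (box_counts l)) =
  \int[P]_x (\1_A x * \prod_(v : m.-tuple 'I_b) \sum_(l : box) q (N v x) (box_counts l) * G v (box_counts l)).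
Proof.
move=> hA; have mA := measurable_history hA.
pose Gk (k : {ffun m.-tuple 'I_b -> box}) := \prod_(v : m.-tuple 'I_b) G v (box_counts (k v)).
transitivity (\int[P]_x (\sum_(k : {ffun m.-tuple 'I_b -> box})
   Gk k * (\1_A x * \prod_(v : m.-tuple 'I_b) (raw_children v x == box_counts (k v))%:R))).
  apply: eq_Rintegral => x _; rewrite bigA_distr_bigA mulr_sumr; apply: eq_bigr => k _.
  by rewrite big_split/= mulrA mulrC.
transitivity (\int[P]_x (\sum_(k : {ffun m.-tuple 'I_b -> box})
   Gk k * (\1_A x * \prod_(v : m.-tuple 'I_b) q (N v x) (box_counts (k v))))); last first.
  apply: eq_Rintegral => x _; rewrite bigA_distr_bigA mulr_sumr; apply: eq_bigr => k _.
  by rewrite big_split/= [RHS]mulrA [RHS]mulrC.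
have b1 k : bounded_var (fun x => \1_A x * \prod_(v : m.-tuple 'I_b) (raw_children v x == box_counts (k v))%:R : R).
  apply: bounded_varM; first exact: bounded_var_indic.
  by apply: bounded_var_prod => v; exact: bounded_var_raw_children.
have b2 k : bounded_var (fun x => \1_A x * \prod_(v : m.-tuple 'I_b) q (N v x) (box_counts (n := n) (k v))).
  apply: bounded_varM; first exact: bounded_var_indic.
  by apply: bounded_var_prod => v; exact: bounded_var_split_kernel.
rewrite !bounded_mean_sum; last 2 first.
- by move=> k; apply: bounded_varM; [exact: bounded_var_cst|exact: b2].
- by move=> k; apply: bounded_varM; [exact: bounded_var_cst|exact: b1].
apply: eq_bigr => k _; rewrite !bounded_meanZ//.
by rewrite (branching_counts _ hA).
Qed.

Lemma sum_box_indic (l0 : {ffun 'I_b -> nat}) g : (forall i, (l0 i <= n)%N) ->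
  \sum_(l : box) (l0 == box_counts l)%:R * g (box_counts l) = g l0.
Proof.
move=> l0n; pose l' : box := [ffun i => inord (l0 i)].
have ll' : box_counts l' = l0 by apply/ffunP => i; rewrite !ffunE inordK// ltnS.
rewrite (bigD1 l')//= ll' eqxx mul1r big1 ?addr0// => k kl'.
case: eqP => E; last by rewrite mul0r.
by move/eqP: kl'; case; apply: (@box_counts_inj b n); rewrite ll'.
Qed.

Lemma sum_box_indic0 (l0 : {ffun 'I_b -> nat}) g : ~ (forall i, (l0 i <= n)%N) ->
  \sum_(l : box) (l0 == box_counts l)%:R * g (box_counts l) = 0.
Proof.
move=> H; rewrite big1// => l _; case: eqP => E; last by rewrite mul0r.
by exfalso; apply: H => i; rewrite E ffunE -ltnS ltn_ord.
Qed.

(** By induction on the generation: at a node with at most [n] balls the kernel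
    gives total mass 1 to the children's counts bounded by [n]. *)
Lemma counts_le_ae : {ae P, forall x, forall v, (N v x <= n)%N}.
Proof.
suff H m : {ae P, forall x, forall v : m.-tuple 'I_b, (N v x <= n)%N}.
  by have := ae_foralln H; apply: filterS => x Hx v; exact: (Hx (size v) (in_tuple v)).
elim: m => [|m IH].
  by apply: aeW => x v; rewrite tuple0; have [-> _ _] := hT.
pose A := [set x | forall v : m.-tuple 'I_b, (N v x <= n)%N].
have hA : hist m A.
  by apply: history_bigcap => v; apply: (history_count [set j | (j <= n)%N]); rewrite size_tuple.
pose A' := [set x | forall v : m.-tuple 'I_b, forall i, (N (rcons v i) x <= n)%N].
have mA' : measurable A'.
  have -> : A' = \bigcap_(t in [set: m.-tuple 'I_b]) \bigcap_(i in [set: 'I_b]) (N (rcons t i) @^-1` [set j | (j <= n)%N]).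
    by apply/seteqP; split => x /= H v; [move=> _ i _; exact: H|move=> i; exact: (H v I i I)].
  by apply: fin_bigcap_measurable => // v _; apply: fin_bigcap_measurable => // i _; exact: measurable_count.
have mA := measurable_history hA.
have PA : \int[P]_x (\1_A x) = 1.
  rewrite -[RHS](bounded_mean_cst P 1); apply: bounded_mean_ae_eq.
  - exact: bounded_var_indic.
  - exact: bounded_var_cst.
  - by apply: filterS IH => x Hx; rewrite indicE mem_set.
have PAA' : \int[P]_x (\1_(A `&` A') x) = 1.
  rewrite -[RHS]PA; have := branching_box (fun _ _ => 1) hA.
  have -> : \int[P]_x (\1_A x * \prod_(v : m.-tuple 'I_b) \sum_(l : box) q (N v x) (box_counts l) * 1) = \int[P]_x (\1_A x).
    apply: eq_Rintegral => x _; rewrite indicE; case: (boolP (x \in A)) => xA; last by rewrite mul0r.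
    rewrite big1 ?mulr1// => v _; rewrite (sum_split_kernel hs01 hV (fun=> 1)) ?offspring_mean_cst//.
    by move/set_mem: xA; exact.
  move=> <-; apply: eq_Rintegral => x _; rewrite indicI; congr (_ * _).
  rewrite indicE; case: (boolP (x \in A')) => xA'.
    rewrite big1// => v _; rewrite (sum_box_indic (fun=> 1))// => i; rewrite ffunE.
    by move/set_mem: xA'; exact.
  have [v Hv] : exists v : m.-tuple 'I_b, ~ forall i, (raw_children v x i <= n)%N.
    apply: contrapT => H; move/negP: xA'; apply; apply/mem_set => v i.
    apply: contrapT => Hvi; apply: H; exists v => Hi.
    by apply: Hvi; move: (Hi i); rewrite ffunE.
  by rewrite (bigD1 v)//= (sum_box_indic0 (fun=> 1))// mul0r.
have PA'1 : P A' = 1%E.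
  apply/eqP; rewrite eq_le probability_le1//=.
  have <- : P (A `&` A') = 1%E.
    move: PAA'; rewrite bounded_mean_indic; last exact: measurableI.
    by move=> H; rewrite -[LHS]fineK ?H// fin_num_measure//; exact: measurableI.
  by apply: le_measure; rewrite ?inE//; exact: measurableI.
have : {ae P, forall x, A' x}.
  have := probability_setC P mA'; rewrite PA'1 subee// => H.
  by apply/negligibleP; [exact: measurableC|exact: H].
apply: filterS => x Hx [v /=]; case/lastP: v => // v i sz.
have sv : size v == m by move: sz; rewrite size_rcons eqSS.
exact: (Hx (Tuple sv) i).
Qed.

(** Truncation changes the counts on a null set only, and makes every variable
    that depends on finitely many of them bounded. *)
Definition count v x : nat := minn (N v x) n.
Definition children v x : {ffun 'I_b -> nat} := [ffun i => count (rcons v i) x].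

Lemma count_le v x : (count v x <= n)%N. Proof. exact: geq_minr. Qed.

Lemma count_ae : {ae P, forall x, forall v, N v x = count v x}.
Proof. by apply: filterS counts_le_ae => x H v; rewrite /count (minn_idPl _). Qed.

Definition state v x : 'I_n.+1 * box :=
  (inord (count v x), [ffun i => inord (children v x i)]).

Lemma state_count v x : (state v x).1 = count v x :> nat.
Proof. by rewrite /= inordK// ltnS count_le. Qed.

Lemma state_children v x : box_counts (state v x).2 = children v x.
Proof. by apply/ffunP => i; rewrite !ffunE inordK// ltnS count_le. Qed.

Lemma history_state m v t : (size v < m)%N -> hist m (state v @^-1` [set t]).
Proof.
move=> vm; have -> : state v @^-1` [set t] =
  (N v @^-1` [set j | minn j n = t.1]) `&`
  [set x | forall i, (N (rcons v i) @^-1` [set j | minn j n = t.2 i]) x].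
  apply/seteqP; split => x /=.
    move=> <-; split; first by rewrite state_count.
    by move=> i /=; rewrite ffunE inordK ?ffunE// ltnS count_le.
  move=> [H1 H2]; rewrite [t]surjective_pairing; congr pair.
    by apply/val_inj; rewrite /= inordK// ltnS count_le.
  apply/ffunP => i; apply/val_inj; rewrite /= ffunE inordK; last by rewrite ltnS ffunE count_le.
  by rewrite ffunE; exact: H2.
apply: history_setI; first by apply: history_count; exact: ltnW.
by apply: history_bigcap => i; apply: history_count; rewrite size_rcons.
Qed.

Lemma measurable_state v t : measurable (state v @^-1` [set t]).
Proof. exact: (measurable_history (history_state t (ltnSn (size v)))). Qed.

Lemma bounded_var_state v (g : nat -> {ffun 'I_b -> nat} -> R) :
  bounded_var (fun x => g (count v x) (children v x)).
Proof.
under eq_fun do rewrite -state_count -state_children.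
exact: (bounded_var_fin (measurable_state v) (fun t => g t.1 (box_counts t.2))).
Qed.

Lemma bounded_var_count v (h : nat -> R) : bounded_var (fun x => h (count v x)).
Proof. exact: (bounded_var_state v (fun a _ => h a)). Qed.

(** Conditionally on the first [m] generations, the children of the nodes of
    generation [m] are independent, with mean given by [offspring_mean]. *)
Lemma branching_mean m A (G : m.-tuple 'I_b -> {ffun 'I_b -> nat} -> R) : hist m A ->
  \int[P]_x (\1_A x * \prod_(v : m.-tuple 'I_b) G v (children v x)) =
  \int[P]_x (\1_A x * \prod_(v : m.-tuple 'I_b) Q (count v x) (G v)).
Proof.
move=> hA; have mA := measurable_history hA.
transitivity (\int[P]_x (\1_A x * \prod_(v : m.-tuple 'I_b) \sum_(l : box) (raw_children v x == box_counts l)%:R * G v (box_counts l))).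
  apply: bounded_mean_ae_eq.
  - apply: bounded_varM; first exact: bounded_var_indic.
    by apply: bounded_var_prod => v; exact: (bounded_var_state _ (fun _ => G v)).
  - apply: bounded_varM; first exact: bounded_var_indic.
    apply: bounded_var_prod => v; apply: bounded_var_sum => l.
    by apply: bounded_varM; [exact: bounded_var_raw_children|exact: bounded_var_cst].
  - apply: filterS2 counts_le_ae count_ae => x Hx Hx'; congr (_ * _).
    apply: eq_bigr => v _; rewrite sum_box_indic.
      by congr (G v); apply/ffunP => i; rewrite !ffunE Hx'.
    by move=> i; rewrite ffunE.
rewrite branching_box//; apply: bounded_mean_ae_eq.
- apply: bounded_varM; first exact: bounded_var_indic.
  apply: bounded_var_prod => v; apply: bounded_var_sum => l.
  by apply: bounded_varM; [exact: bounded_var_split_kernel|exact: bounded_var_cst].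
- apply: bounded_varM; first exact: bounded_var_indic.
  by apply: bounded_var_prod => v; exact: (bounded_var_count _ (fun a => Q a (G v))).
- apply: filterS2 counts_le_ae count_ae => x Hx Hx'; congr (_ * _).
  by apply: eq_bigr => v _; rewrite (sum_split_kernel hs01 hV (G v))// Hx'.
Qed.

Lemma history_count_eq m v a : (size v <= m)%N -> hist m [set x | count v x = a].
Proof. by move=> vm; exact: (history_count [set j | minn j n = a] vm). Qed.

Lemma branching_mean1 m A (v : m.-tuple 'I_b) g : hist m A ->
  \int[P]_x (\1_A x * g (children v x)) = \int[P]_x (\1_A x * Q (count v x) g).
Proof.
move=> hA; have := branching_mean (fun w => if w == v then g else fun=> 1) hA.
under eq_Rintegral => x _.
  rewrite (bigD1 v)//= eqxx big1 ?mulr1; last by move=> w /negPf ->.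
  over.
move=> ->; apply: eq_Rintegral => x _; congr (_ * _).
rewrite (bigD1 v)//= eqxx big1 ?mulr1// => w /negPf ->.
exact: offspring_mean_cst.
Qed.

Lemma branching_mean2 m A (u v : m.-tuple 'I_b) g g' : hist m A -> u != v ->
  \int[P]_x (\1_A x * (g' (children u x) * g (children v x))) =
  \int[P]_x (\1_A x * (Q (count u x) g' * Q (count v x) g)).
Proof.
move=> hA uv; have vu : v != u by rewrite eq_sym.
have := branching_mean (fun w => if w == u then g' else if w == v then g else fun=> 1) hA.
under eq_Rintegral => x _.
  rewrite (bigD1 u)//= eqxx (bigD1 v)//= (negPf vu) eqxx big1 ?mulr1; last first.
    by move=> w /andP[/negPf -> /negPf ->].
  over.
move=> ->; apply: eq_Rintegral => x _; congr (_ * _).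
rewrite (bigD1 u)//= eqxx (bigD1 v)//= (negPf vu) eqxx big1 ?mulr1//.
move=> w /andP[/negPf -> /negPf ->]; exact: offspring_mean_cst.
Qed.

Lemma sum_count_indic v x (F : nat -> R) :
  F (count v x) = \sum_(a < n.+1) \1_[set y | count v y = a] x * F a.
Proof.
have cn : (count v x < n.+1)%N by rewrite ltnS count_le.
rewrite (bigD1 (Ordinal cn))//= indicE mem_set// mul1r big1 ?addr0// => a ac.
rewrite indicE memNset ?mul0r//= => E; move/eqP: ac; apply; apply/val_inj.
by rewrite /= E.
Qed.

Lemma measurable_count_eq v a : measurable [set x | count v x = a].
Proof. exact: (measurable_history (history_count_eq a (leqnn (size v)))). Qed.

Lemma bounded_var_children v g : bounded_var (fun x => g (children v x)).
Proof. exact: (bounded_var_state v (fun _ => g)). Qed.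

(** Decompose according to the count of [v], which belongs to the history. *)
Lemma mean_state v (g : nat -> {ffun 'I_b -> nat} -> R) :
  \int[P]_x g (count v x) (children v x) = \int[P]_x Q (count v x) (g (count v x)).
Proof.
transitivity (\int[P]_x (\sum_(a < n.+1) \1_[set y | count v y = a] x * g a (children v x))).
  by apply: eq_Rintegral => x _; rewrite -(sum_count_indic v x (fun a => g a (children v x))).
transitivity (\int[P]_x (\sum_(a < n.+1) \1_[set y | count v y = a] x * Q (count v x) (g a))); last first.
  by apply: eq_Rintegral => x _; rewrite -(sum_count_indic v x (fun a => Q (count v x) (g a))).
rewrite !bounded_mean_sum; last 2 first.
- move=> a; apply: bounded_varM; first exact/bounded_var_indic/measurable_count_eq.
  exact: (bounded_var_count v (fun c => Q c (g a))).
- move=> a; apply: bounded_varM; first exact/bounded_var_indic/measurable_count_eq.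
  exact: bounded_var_children.
apply: eq_bigr => a _.
by apply: (branching_mean1 (in_tuple v)); exact: history_count_eq.
Qed.

(** * Orthogonality of the increments *)
Section orthogonality.
Variable xi : nat -> {ffun 'I_b -> nat} -> R.
Hypothesis xi0 : forall a, (a <= n)%N -> Q a (xi a) = 0.
Let xiv v x := xi (count v x) (children v x).

Lemma bounded_var_xi v : bounded_var (xiv v).
Proof. exact: bounded_var_state. Qed.

(** The increment at [u] belongs to the history of the generation of [v], given
    which the increment at [v] has mean zero. *)
Lemma orthogonal_lt u v : (size u < size v)%N -> \int[P]_x (xiv u x * xiv v x) = 0.
Proof.
move=> uv.
transitivity (\int[P]_x (\sum_(t : 'I_n.+1 * box) \sum_(a < n.+1)
   xi t.1 (box_counts t.2) *
   (\1_((state u @^-1` [set t]) `&` [set y | count v y = a]) x * xi a (children v x)))).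
  apply: eq_Rintegral => x _; rewrite (bigD1 (state u x))//= [X in _ + X]big1 ?addr0; last first.
    move=> t tu; rewrite big1// => a _; rewrite indicE memNset ?mul0r ?mulr0//= => -[E _].
    by rewrite E eqxx in tu.
  rewrite -mulr_sumr state_children inordK ?ltnS ?count_le//; congr (_ * _).
  rewrite /xiv (sum_count_indic v x (fun a => xi a (children v x))).
  apply: eq_bigr => a _; rewrite indicI/= [X in _ = X * _ * _]indicE mem_set//.
  by rewrite mul1r.
have bv t a : bounded_var (fun x =>
  \1_((state u @^-1` [set t]) `&` [set y | count v y = a]) x * xi a (children v x)).
  apply: bounded_varM; last exact: bounded_var_children.
  apply/bounded_var_indic/measurableI; first exact: measurable_state.
  exact: measurable_count_eq.
rewrite bounded_mean_sum; last first.
  by move=> t; apply: bounded_var_sum => a; apply: bounded_varM => //; exact: bounded_var_cst.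
rewrite big1// => t _; rewrite bounded_mean_sum; last first.
  by move=> a; apply: bounded_varM => //; exact: bounded_var_cst.
rewrite big1// => a _; rewrite bounded_meanZ//.
rewrite (branching_mean1 (in_tuple v)); last first.
  by apply: history_setI; [exact: history_state|exact: history_count_eq].
under eq_Rintegral => x _.
  rewrite (_ : _ * _ = 0); last first.
    rewrite indicE; case: (boolP (x \in _)) => [/set_mem[_ /= ->]|]; last by rewrite mul0r.
    by rewrite xi0 ?mulr0// -ltnS.
  over.
by rewrite (bounded_mean_cst P 0) mulr0.
Qed.

(** Two nodes of one generation split independently, given the past. *)
Lemma orthogonal_eq m (u v : m.-tuple 'I_b) : u != v -> \int[P]_x (xiv u x * xiv v x) = 0.
Proof.
move=> uv.
transitivity (\int[P]_x (\sum_(a' < n.+1) \sum_(a < n.+1)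
   (\1_([set y | count u y = a'] `&` [set y | count v y = a]) x *
      (xi a' (children u x) * xi a (children v x))))).
  apply: eq_Rintegral => x _.
  rewrite /xiv (sum_count_indic u x (fun a => xi a (children u x))) mulr_suml.
  apply: eq_bigr => a' _; rewrite -mulrA.
  rewrite (sum_count_indic v x (fun a => xi a (children v x))) !mulr_sumr.
  by apply: eq_bigr => a _; rewrite indicI/=; ring.
have hA (a' a : nat) : hist m ([set y | count u y = a'] `&` [set y | count v y = a]).
  by apply: history_setI; apply: history_count_eq; rewrite size_tuple.
have bv (a' a : nat) : bounded_var (fun x =>
  \1_([set y | count u y = a'] `&` [set y | count v y = a]) x * (xi a' (children u x) * xi a (children v x))).
  apply: bounded_varM; first exact/bounded_var_indic/(measurable_history (hA _ _)).
  by apply: bounded_varM; exact: bounded_var_children.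
rewrite bounded_mean_sum; last by move=> a'; apply: bounded_var_sum => a.
rewrite big1// => a' _; rewrite bounded_mean_sum//.
rewrite big1// => a _; rewrite (branching_mean2 _ _ (hA _ _) uv).
under eq_Rintegral => x _.
  rewrite (_ : _ * _ = 0); last first.
    rewrite indicE; case: (boolP (x \in _)) => [/set_mem[_ /= ->]|]; last by rewrite mul0r.
    by rewrite xi0 ?mulr0// -ltnS.
  over.
exact: (bounded_mean_cst P 0).
Qed.

Lemma orthogonal u v : u != v -> \int[P]_x (xiv u x * xiv v x) = 0.
Proof.
move=> uv; have [suv|svu|sE] := ltngtP (size u) (size v).
- exact: orthogonal_lt.
- by under eq_Rintegral do rewrite mulrC; exact: orthogonal_lt.
- pose u' : (size v).-tuple 'I_b := Tuple (introT eqP sE).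
  apply: (@orthogonal_eq _ u' (in_tuple v)).
  by apply: contra uv => /eqP/(congr1 val) /= ->.
Qed.

Lemma variance_sum (r : seq (node b)) : uniq r ->
  \int[P]_x ((\sum_(v <- r) xiv v x) ^+ 2) =
  \sum_(v <- r) \int[P]_x Q (count v x) (fun l => xi (count v x) l ^+ 2).
Proof.
elim: r => [_|v r IH /andP[vr ur]].
  rewrite big_nil; under eq_Rintegral do rewrite big_nil expr0n.
  exact: (bounded_mean_cst P 0).
rewrite big_cons -IH//.
have bS : bounded_var (fun x => \sum_(u <- r) xiv u x).
  by apply: bounded_var_sum => u; exact: bounded_var_xi.
under eq_Rintegral => x _.
  rewrite big_cons (_ : _ ^+ 2 = (xiv v x ^+ 2 + 2 * (xiv v x * \sum_(u <- r) xiv u x)) + (\sum_(u <- r) xiv u x) ^+ 2); last by ring.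
  over.
have bvS : bounded_var (fun x => xiv v x * \sum_(u <- r) xiv u x).
  by apply: bounded_varM => //; exact: bounded_var_xi.
rewrite bounded_meanD; last 2 first.
- apply: bounded_varD; first by apply: bounded_varX; exact: bounded_var_xi.
  by apply: bounded_varM => //; exact: bounded_var_cst.
- exact: bounded_varX.
rewrite bounded_meanD; last 2 first.
- by apply: bounded_varX; exact: bounded_var_xi.
- by apply: bounded_varM => //; exact: bounded_var_cst.
rewrite bounded_meanZ//.
under [X in 2 * X]eq_Rintegral do rewrite mulr_sumr.
rewrite bounded_mean_sum; last by move=> u; apply: bounded_varM; exact: bounded_var_xi.
rewrite big_seq big1 ?mulr0 ?addr0; last first.
  by move=> u ur'; apply: orthogonal; apply: contraNneq vr => ->.
congr (_ + _); exact: (mean_state v (fun a l => xi a l ^+ 2)).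
Qed.

End orthogonality.

End process.

(** * Sums over generations *)
Section generations.
Variable b : nat.

Fixpoint generation (k : nat) : seq (node b) :=
  if k is k'.+1 then [seq rcons v i | v <- generation k', i <- enum 'I_b]
  else [:: [::]].

(** The words of length at least [k] and less than [k + K]. *)
Fixpoint generations (k K : nat) : seq (node b) :=
  if K is K'.+1 then generations k K' ++ generation (k + K') else [::].

Lemma mem_generation k (v : node b) : (v \in generation k) = (size v == k).
Proof.
elim: k v => [|k IH] v /=; first by rewrite inE size_eq0.
apply/allpairsP/idP => [[[u i] /= [uk _ ->]]|].
  by rewrite size_rcons eqSS -IH.
case/lastP: v => // v i; rewrite size_rcons eqSS -IH => vk.
by exists (v, i); split => //=; rewrite mem_enum.
Qed.

Lemma uniq_generation k : uniq (generation k).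
Proof.
elim: k => //= k IH; apply: allpairs_uniq => //; first exact: enum_uniq.
by move=> [u i] [v j] _ _ /= /rcons_inj [-> ->].
Qed.

Lemma mem_generations k K (v : node b) : (v \in generations k K) = (k <= size v < k + K)%N.
Proof.
elim: K => [|K IH] /=; first by rewrite addn0; apply/esym/negbTE; lia.
by rewrite mem_cat IH mem_generation; lia.
Qed.

Lemma uniq_generations k K : uniq (generations k K).
Proof.
elim: K => //= K IH; rewrite cat_uniq IH uniq_generation andbT.
apply/hasPn => v; rewrite mem_generation mem_generations => /eqP ->.
by rewrite ltnn andbF.
Qed.

Lemma big_generationS (R : zmodType) k (F : node b -> R) :
  \sum_(v <- generation k.+1) F v = \sum_(v <- generation k) \sum_i F (rcons v i).
Proof.
rewrite /= big_allpairs_dep; apply: eq_bigr => v _.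
by rewrite big_enum.
Qed.

End generations.

(** * The martingale and its limit *)
Section growth.
Context (R : realType) (b s s0 s1 : nat) (hs01 : (b * s1 + s0 <= s.+1)%N)
  (d0 : measure_display) (Om0 : measurableType d0) (P0 : probability Om0 R)
  (V : 'I_b -> {RV P0 >-> R}).
Hypothesis hV : forall x, (forall i, 0 <= V i x) /\ \sum_(i < b) V i x <= 1.
Context (d : measure_display) (Om : measurableType d) (P : probability Om R)
  (W : node b -> 'I_b -> {RV P >-> R}) (N : node b -> {RV P >-> nat}) (n : nat).
Hypothesis hT : is_split_tree V W N s s0 s1 n.
Implicit Types (g : {ffun 'I_b -> nat} -> R) (l : {ffun 'I_b -> nat}) (u v : node b).
Local Notation Q := (offspring_mean s s0 s1 V).
Local Notation C := (count N n).
Local Notation L := (children N n).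

Let bvC v (h : nat -> R) : bounded_var (fun x => h (C v x)).
Proof. exact: (bounded_var_count W N n v h). Qed.
Let bvCL v (g : nat -> {ffun 'I_b -> nat} -> R) : bounded_var (fun x => g (C v x) (L v x)).
Proof. exact: (bounded_var_state W N n v g). Qed.

Definition generation_mean (h : nat -> R) (k : nat) : R :=
  \sum_(v <- generation b k) \int[P]_x h (C v x).

Lemma count_root x : C [::] x = n.
Proof. by rewrite /count; have [-> _ _] := hT; rewrite minnn. Qed.

Lemma generation_mean0 h : generation_mean h 0 = h n.
Proof.
rewrite /generation_mean big_seq1; under eq_Rintegral => x _ do rewrite count_root.
exact: (bounded_mean_cst P (h n)).
Qed.

Lemma generation_meanS h k :
  generation_mean h k.+1 = generation_mean (fun a => Q a (fun l => \sum_i h (l i))) k.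
Proof.
rewrite /generation_mean big_generationS; apply: eq_bigr => v _.
rewrite -(mean_state hs01 hV hT v (fun _ l => \sum_i h (l i))).
rewrite bounded_mean_sum => [|i]; last first.
  exact: (bvCL v (fun _ l => h (l i))).
by apply: eq_bigr => i _; apply: eq_Rintegral => x _; rewrite ffunE.
Qed.

Lemma ler_generation_mean h h' k : (forall a, (a <= n)%N -> h a <= h' a) ->
  generation_mean h k <= generation_mean h' k.
Proof.
move=> hh'; apply: ler_sum => v _; apply: ler_bounded_mean => // x.
by apply: hh'; exact: count_le.
Qed.

Lemma generation_meanD h h' k :
  generation_mean (fun a => h a + h' a) k = generation_mean h k + generation_mean h' k.
Proof.
rewrite /generation_mean -big_split; apply: eq_bigr => v _.
exact: bounded_meanD.
Qed.

Lemma generation_mean_ge0 h k : (forall a, 0 <= h a) -> 0 <= generation_mean h k.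
Proof. by move=> h0; apply: sumr_ge0 => v _; apply: bounded_mean_ge0. Qed.

(** If [h] pays the cost [t] of a node and leaves enough for its children, then
    [h] pays for all descendants: induct on the number of generations. *)
Lemma superharmonic_bound (t h : nat -> R) k K :
  (forall a, (a <= n)%N -> t a + Q a (fun l => \sum_i h (l i)) <= h a) ->
  \sum_(v <- generations b k K) \int[P]_x t (C v x) + generation_mean h (k + K) <=
  generation_mean h k.
Proof.
move=> th; elim: K => [|K IH]; first by rewrite big_nil addn0 add0r.
rewrite /= big_cat/= -addrA addnS; apply: le_trans IH; rewrite lerD2l.
rewrite generation_meanS -generation_meanD; exact: ler_generation_mean.
Qed.

Section martingale.
Variables (toll : nat -> {ffun 'I_b -> nat} -> R) (mu : nat -> R).

(** The best prediction of the functional, given the first [k] generations. *)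
Definition partial_sum k x : R :=
  \sum_(v <- generations b 0 k) toll (C v x) (L v x) + \sum_(v <- generation b k) mu (C v x).

Let xi a l := toll a l + \sum_i mu (l i) - mu a.

Lemma partial_sum0 x : partial_sum 0 x = mu n.
Proof. by rewrite /partial_sum big_nil big_seq1 count_root add0r. Qed.

Lemma partial_sum_diff k K x :
  partial_sum (k + K) x - partial_sum k x = \sum_(v <- generations b k K) xi (C v x) (L v x).
Proof.
elim: K => [|K IH]; first by rewrite addn0 subrr big_nil.
rewrite /= big_cat -IH addnS/=.
have -> : \sum_(v <- generation b (k + K)) xi (C v x) (L v x) =
   \sum_(v <- generation b (k + K)) toll (C v x) (L v x) +
   \sum_(v <- generation b (k + K).+1) mu (C v x) - \sum_(v <- generation b (k + K)) mu (C v x).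
  rewrite big_generationS -big_split -sumrB; apply: eq_bigr => v _.
  by rewrite /xi; congr (_ + _ - _); apply: eq_bigr => i _; rewrite ffunE.
by rewrite /partial_sum /= add0n big_cat/=; ring.
Qed.

Lemma bounded_var_partial_sum k : bounded_var (partial_sum k).
Proof.
by apply: bounded_varD; apply: bounded_var_sum => v.
Qed.

Hypothesis muE : forall a, (a <= n)%N -> mu a = Q a (fun l => toll a l + \sum_i mu (l i)).
Variable h : nat -> R.
Hypothesis h0 : forall a, 0 <= h a.
Hypothesis hQ : forall a, (a <= n)%N ->
  Q a (fun l => (toll a l + \sum_i mu (l i) - mu a) ^+ 2) + Q a (fun l => \sum_i h (l i)) <= h a.

Lemma partial_sum_var k K :
  \int[P]_x ((partial_sum (k + K) x - partial_sum k x) ^+ 2) <= generation_mean h k.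
Proof.
under eq_Rintegral do rewrite partial_sum_diff.
rewrite (variance_sum hs01 hV hT _ (uniq_generations b k K)); last first.
  move=> a an; rewrite /xi offspring_meanD// -muE//.
  by rewrite (offspring_mean_cst s s0 s1 V a (- mu a)) subrr.
have := @superharmonic_bound (fun a => Q a (fun l => xi a l ^+ 2)) h k K hQ.
by apply: le_trans; rewrite lerDl generation_mean_ge0.
Qed.

(** Fatou's lemma, from the uniform bound [partial_sum_var]. *)
Lemma limit_var (Y : Om -> R) k : measurable_fun setT Y ->
  {ae P, forall x, exists K0, forall K, (K0 <= K)%N -> partial_sum K x = Y x} ->
  (\int[P]_x ((Y x - partial_sum k x) ^+ 2)%:E <= (generation_mean h k)%:E)%E.
Proof.
move=> mY [Z [mZ PZ subZ]].
pose F K x : \bar R := ((partial_sum (k + K) x - partial_sum k x) ^+ 2)%:E.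
have bF K : bounded_var (fun x => (partial_sum (k + K) x - partial_sum k x) ^+ 2).
  apply: bounded_varX; apply: bounded_varD; first exact: bounded_var_partial_sum.
  under eq_fun do rewrite -mulN1r; apply: bounded_varM; first exact: bounded_var_cst.
  exact: bounded_var_partial_sum.
have mF K : measurable_fun setT (F K).
  by apply/measurable_EFinP; case: (bF K).
have mZC : measurable (~` Z) by exact: measurableC.
have mG : measurable_fun setT (fun x => ((Y x - partial_sum k x) ^+ 2)%:E).
  apply/measurable_EFinP; apply: measurable_funX; apply: measurable_funB => //.
  by case: (bounded_var_partial_sum k).
rewrite (ge0_negligible_integral mZ _ _ _ PZ)//; last first.
  by move=> x _; rewrite lee_fin sqr_ge0.
rewrite setTD.
apply: (@le_trans _ _ (\int[P]_(x in ~` Z) limn_einf (F^~ x))%E).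
  rewrite le_eqVlt; apply/orP; left; apply/eqP; apply: eq_integral => x /set_mem xZ.
  have [K0 HK0] : exists K0, forall K, (K0 <= K)%N -> partial_sum K x = Y x.
    by apply: contrapT => nK; apply: xZ; apply: subZ.
  have : F^~ x @ \oo --> ((Y x - partial_sum k x) ^+ 2)%:E.
    apply: cvg_near_cst; exists K0 => // K /= K0K; rewrite /F HK0//.
    by rewrite (leq_trans K0K)// leq_addl.
  by move/cvg_limn_einf_sup => [].
apply: le_trans (fatou P mZC _ _) _.
- by move=> K; apply: measurable_funTS.
- by move=> K x _; rewrite lee_fin sqr_ge0.
rewrite limn_einf_lim; apply: lime_le; first exact: is_cvg_einfs.
apply: nearW => K; apply: le_trans (_ : \int[P]_(x in ~` Z) F K x <= _)%E.
  by apply: ereal_inf_lbound; exists K => /=.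
apply: le_trans (_ : \int[P]_x F K x <= _)%E.
  by apply: ge0_subset_integral => // x _; rewrite lee_fin sqr_ge0.
rewrite /F bounded_var_EFin// lee_fin; exact: partial_sum_var.
Qed.

End martingale.

Section extinction.
Variable psi : nat -> R.
Hypothesis psi0 : forall a, 0 <= psi a.
Hypothesis psiQ : forall a, (0 < a)%N%:R + Q a (fun l => \sum_i psi (l i)) <= psi a.

Lemma sum_population K :
  \sum_(k < K) generation_mean (fun a => (0 < a)%N%:R) k <= psi n.
Proof.
have := @superharmonic_bound (fun a => (0 < a)%N%:R) psi 0 K (fun a _ => psiQ a).
rewrite generation_mean0; apply: le_trans.
have -> : \sum_(k < K) generation_mean (fun a => (0 < a)%N%:R) k =
   \sum_(v <- generations b 0 K) \int[P]_x (0 < C v x)%N%:R.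
  elim: K => [|K IH]; first by rewrite big_ord0 big_nil.
  by rewrite big_ord_recr/= big_cat/= -IH.
by rewrite lerDl generation_mean_ge0.
Qed.

(** The mean numbers of nonempty nodes of the generations have a finite sum. *)
Lemma population_small (e : R) : 0 < e ->
  exists k, generation_mean (fun a => (0 < a)%N%:R) k < e.
Proof.
move=> e0; apply: contrapT => H.
have {}H k : e <= generation_mean (fun a => (0 < a)%N%:R) k.
  by rewrite leNgt; apply/negP => ?; apply: H; exists k.
pose K := Num.bound (psi n / e).
have := sum_population K; apply/negP; rewrite -ltNge.
apply: (@lt_le_trans _ _ (\sum_(k < K) e)); last exact: ler_sum.
rewrite sumr_const card_ord -[ltRHS]mulr_natl -ltr_pdivrMr//.
by apply: archi_boundP; rewrite divr_ge0// ltW.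
Qed.

(** The probability that generation [k] is not empty is at most its mean number
    of nonempty nodes; and an empty node has only empty descendants. *)
Lemma extinction_ae : {ae P, forall x, exists k, forall v, (k <= size v)%N -> N v x = 0%N}.
Proof.
pose B k := [set x | exists2 v, size v = k & (0 < C v x)%N].
have mBv v : measurable [set x | (0 < C v x)%N].
  exact: (measurable_count N v [set j | (0 < minn j n)%N]).
have BE k : B k = \bigcup_(t in [set: k.-tuple 'I_b]) [set x | (0 < C t x)%N].
  apply/seteqP; split => x /=.
    by move=> [v sv Cv]; exists (Tuple (introT eqP sv)).
  by move=> [t _ Ct]; exists t => //; rewrite size_tuple.
have mB k : measurable (B k).
  by rewrite BE; apply: fin_bigcup_measurable.
have PB k : \int[P]_x (\1_(B k) x) <= generation_mean (fun a => (0 < a)%N%:R) k.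
  rewrite /generation_mean -bounded_mean_sum; last first.
    by move=> v; exact: (bvC v (fun a => (0 < a)%N%:R)).
  apply: ler_bounded_mean; first exact: bounded_var_indic.
    by apply: bounded_var_sum => v; exact: (bvC v (fun a => (0 < a)%N%:R)).
  move=> x; rewrite indicE; case: (boolP (x \in B k)) => [/set_mem[v sv Cv]|_]; last first.
    by apply: sumr_ge0 => v _; rewrite ler0n.
  have vk : v \in generation b k by rewrite mem_generation sv.
  by rewrite (perm_big _ (perm_to_rem vk)) big_cons Cv lerDl sumr_ge0.
pose BI := \bigcap_k B k.
have mBI : measurable BI by exact: bigcapT_measurable.
have PBI : P BI = 0%E.
  have P0' : fine (P BI) = 0.
    apply/eqP; rewrite eq_le fine_ge0 ?measure_ge0// andbT leNgt; apply/negP => Pgt.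
    have [k] := population_small Pgt; apply/negP; rewrite -leNgt.
    apply: le_trans (PB k); rewrite -bounded_mean_indic//.
    apply: ler_bounded_mean; [exact: bounded_var_indic|exact: bounded_var_indic|move=> x].
    rewrite !indicE; case: (boolP (x \in BI)) => [/set_mem H|_]; last by rewrite ler0n.
    by rewrite mem_set//; exact: H.
  by rewrite -[LHS]fineK ?P0'// fin_num_measure.
have : {ae P, forall x, (~` BI) x}.
  by apply/negligibleP; rewrite ?setCK//; rewrite (_ : [set _ | _] = ~` BI) ?setCK.
apply: filterS2 (count_ae hs01 hV hT) => x HC Hx.
have [k Hk] : exists k, ~ B k x.
  by apply: contrapT => H; apply: Hx => k _; apply: contrapT => H'; apply: H; exists k.
exists k.+1 => v kv.
have [_ tree _] := hT.
rewrite -(cat_take_drop k v); apply: tree.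
  rewrite HC leqNgt; apply/negP => sC; apply: Hk; exists (take k v).
    by rewrite size_takel// ltnW.
  exact: leq_ltn_trans sC.
by rewrite -size_eq0 size_drop -lt0n subn_gt0.
Qed.

End extinction.
End growth.

(** * Mean and variance of the additive functional *)
Section functional.
Context (R : realType) (b s s0 s1 : nat) (hs01 : (b * s1 + s0 <= s.+1)%N)
  (d0 : measure_display) (Om0 : measurableType d0) (P0 : probability Om0 R)
  (V : 'I_b -> {RV P0 >-> R}).
Hypothesis hV : forall x, (forall i, 0 <= V i x) /\ \sum_(i < b) V i x <= 1.
Context (d : measure_display) (Om : measurableType d) (P : probability Om R)
  (W : node b -> 'I_b -> {RV P >-> R}) (N : node b -> {RV P >-> nat}) (n : nat).
Hypothesis hT : is_split_tree V W N s s0 s1 n.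
Implicit Types (g : {ffun 'I_b -> nat} -> R) (l : {ffun 'I_b -> nat}) (u v : node b).
Local Notation Q := (offspring_mean s s0 s1 V).
Local Notation C := (count N n).
Local Notation L := (children N n).
Variables (phi : counts b -> R) (f : {ffun 'I_b -> nat} -> R).
Hypothesis phif : forall t : counts b,
  ball_tree s t -> (0 < t [::])%N -> phi t = f [ffun i => t [:: i]].

(** An empty node is not a node of the tree and pays no toll. *)
Definition toll (a : nat) l : R := if (0 < a)%N then f l else 0.
Let g v x := toll (N v x) (raw_children N v x).
Let X x := additive_functional phi (fun v => N v x).

Lemma additive_functionalE x : X x = \sum_(v \in [set: node b]) g v x.
Proof.
rewrite /X /additive_functional.
transitivity (\sum_(v \in tree_nodes (fun v => N v x)) g v x).
  apply: eq_fsbigr => v /set_mem /= Nv; rewrite /g /toll Nv.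
  have [_ tree _] := hT.
  rewrite phif /fringe ?cats0//; last first.
    by move=> u w uw w0; rewrite catA; apply: tree.
  by congr f; apply/ffunP => i; rewrite !ffunE cats1.
apply: fsbig_widen => // v [_ /= /negP]; rewrite -leqNgt leqn0 => /eqP Nv.
by rewrite /g /toll Nv.
Qed.

Lemma measurable_node_toll v (B : set R) : measurable [set x | B (g v x)].
Proof.
pose T := (nat * {ffun 'I_b -> nat})%type.
have -> : [set x | B (g v x)] = \bigcup_(t in [set: T])
   (if pselect (B (toll t.1 t.2)) then (N v @^-1` [set t.1]) `&` [set x | raw_children N v x = t.2] else set0).
  apply/seteqP; split => x /=.
    by move=> Bx; exists (N v x, raw_children N v x) => //=; case: pselect.
  by move=> [t _]; case: pselect => //= Bt [/= Nv rv]; rewrite /g Nv rv.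
apply: countable_bigcupT_measurable; first exact: countableP.
move=> t; case: pselect => [?|?] //=; apply: measurableI; first exact: measurable_count.
exact: measurable_raw_children.
Qed.

Let S k x := \sum_(v <- generations b 0 k) g v x.
Let Fin := [set x | exists k, forall v, (k <= size v)%N -> g v x = 0].

Lemma functional_eq_sum x k : (forall v, (k <= size v)%N -> g v x = 0) -> X x = S k x.
Proof.
move=> H; rewrite additive_functionalE /S (fsbig_seq _ _ (uniq_generations b 0 k)).
apply/esym/fsbig_widen => // v [_ /= /negP]; rewrite mem_generations add0n/= -leqNgt.
exact: H.
Qed.

(** With infinitely many nonzero terms the sum takes its default value. *)
Lemma functional_infinite x : ~ Fin x -> X x = 0.
Proof.
move=> nF; rewrite additive_functionalE; apply: fsbig_dflt.
rewrite setTI => /finite_seqP[r rE]; apply: nF.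
exists (\max_(v <- r) size v).+1 => v vr; apply: contrapT => gv.
have : v \in r by have : [set` r] v by rewrite -rE /=; exact: gv.
by move=> vr'; move: vr; apply/negP; rewrite -ltnNge ltnS; exact: leq_bigmax_seq.
Qed.

(** On the measurable event [Fin] that finitely many tolls are nonzero the
    functional is the limit of the sums over the first [k] generations; off
    this event it is 0. *)
Lemma measurable_functional : measurable_fun setT X.
Proof.
have mFin : measurable Fin.
  have -> : Fin = \bigcup_k ~` (\bigcup_(v in [set: node b])
      (if (k <= size v)%N then [set x | g v x <> 0] else set0)).
    apply/seteqP; split => x /=.
      move=> [k H]; exists k => // -[v _]; case: ifP => // kv /=; apply; exact: H.
    move=> [k _ /= H]; exists k => v kv; apply: contrapT => gv; apply: H.
    by exists v => //; rewrite kv.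
  apply: bigcupT_measurable => k; apply: measurableC.
  apply: countable_bigcupT_measurable; first exact: countableP.
  by move=> v; case: ifP => // _; exact: (measurable_node_toll v [set y | y <> 0]).
apply: (@measurable_fun_cvg _ _ _ setT (fun k x => \1_Fin x * S k x)).
  move=> k; apply: measurable_funM; first exact: measurable_indic.
  apply: measurable_sum => v _ B mB; rewrite setTI; exact: measurable_node_toll.
move=> x _; have [Fx|nFx] := pselect (Fin x); last first.
  rewrite functional_infinite//; apply: cvg_near_cst; apply: nearW => k.
  by rewrite indicE memNset// mul0r.
have [k Hk] := Fx; apply: cvg_near_cst; exists k => // k' /= kk'.
rewrite indicE mem_set// mul1r; apply/esym/functional_eq_sum => v k'v.
by apply: Hk; apply: leq_trans k'v.
Qed.

Section mean_variance.
Variable psi : nat -> R.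
Hypothesis psi0 : forall a, 0 <= psi a.
Hypothesis psi00 : psi 0%N = 0.
Hypothesis psiQ : forall a, (0 < a)%N%:R + Q a (fun l => \sum_i psi (l i)) <= psi a.
Variable mu : nat -> R.
Hypothesis mu0 : mu 0%N = 0.
Hypothesis muE : forall a, (a <= n)%N -> mu a = Q a (fun l => toll a l + \sum_i mu (l i)).
Let M := partial_sum N n toll mu.

Lemma partial_sum_cvg :
  {ae P, forall x, exists K0, forall K, (K0 <= K)%N -> M K x = X x}.
Proof.
have := extinction_ae hs01 hV hT psi0 psiQ.
apply: filterS2 (count_ae hs01 hV hT) => x HC [k Hk]; exists k => K kK.
have gK v : (K <= size v)%N -> g v x = 0.
  by move=> Kv; rewrite /g /toll Hk// (leq_trans kK).
rewrite (functional_eq_sum gK) /M /partial_sum [X in _ + X]big1_seq ?addr0; last first.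
  move=> v /andP[_]; rewrite mem_generation => /eqP vK.
  by rewrite -HC Hk ?mu0// vK.
apply: eq_bigr => v _; rewrite /g -HC; congr toll.
by apply/ffunP => i; rewrite !ffunE HC.
Qed.

Lemma functional_var (h : nat -> R) : (forall a, 0 <= h a) ->
  (forall a, (a <= n)%N ->
  Q a (fun l => (toll a l + \sum_i mu (l i) - mu a) ^+ 2) + Q a (fun l => \sum_i h (l i)) <= h a) ->
  (\int[P]_x ((X x - mu n) ^+ 2)%:E <= (h n)%:E)%E.
Proof.
move=> h0 hQ.
have := limit_var hs01 hV hT muE h0 hQ 0 measurable_functional partial_sum_cvg.
under eq_integral do rewrite (partial_sum0 hT).
by rewrite (generation_mean0 hT).
Qed.

(** Here [limit_var] is applied with a multiple of [psi]: there are finitely many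
    one-step variances at counts up to [n], so that [B * psi] dominates them, and
    the bound tends to 0 with the mean size of generation [k]. *)
Lemma functional_approx (e : R) : 0 < e ->
  exists k, (\int[P]_x ((X x - M k x) ^+ 2)%:E <= e%:E)%E.
Proof.
move=> e0.
pose D a := Q a (fun l => (toll a l + \sum_i mu (l i) - mu a) ^+ 2).
have D0 a : 0 <= D a.
  rewrite -[leLHS](offspring_mean_cst s s0 s1 V a 0).
  by apply: ler_offspring_mean => // l _; exact: sqr_ge0.
pose B := \sum_(a < n.+1) D a.
have B0 : 0 <= B by apply: sumr_ge0 => a _.
have DB a : (a <= n)%N -> D a <= B.
  by move=> an; rewrite /B (bigD1 (Ordinal (an : a < n.+1)%N))//= lerDl sumr_ge0.
pose h a := B * psi a.
have h0 a : 0 <= h a by rewrite mulr_ge0.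
have hQ a : (a <= n)%N -> D a + Q a (fun l => \sum_i h (l i)) <= h a.
  move=> an.
  rewrite (@eq_offspring_mean _ _ _ _ _ hs01 _ _ _ _ hV _ _
     (fun l => B * \sum_i psi (l i))); last by move=> l _; rewrite mulr_sumr.
  rewrite offspring_meanZ//; case: a an => [_|a an].
    rewrite offspring_mean_empty// mulr0 addr0 /h psi00 mulr0 /D offspring_mean_leaf// /toll/=.
    by rewrite big1 ?mu0 ?subr0 ?addr0 ?expr0n// => i _; rewrite ffunE.
  apply: le_trans (ler_wpM2l B0 (psiQ a.+1)).
  by rewrite mulrDr lerD2r mulr1 DB.
pose Cm := \sum_(a < n.+1) h a.
have Cm0 : 0 <= Cm by apply: sumr_ge0 => a _.
have hC a : (a <= n)%N -> h a <= Cm * (0 < a)%N%:R.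
  case: a => [_|a an]; first by rewrite /h psi00 !mulr0.
  by rewrite mulr1 /Cm (bigD1 (Ordinal (an : a.+1 < n.+1)%N))//= lerDl sumr_ge0.
have e0' : 0 < e / (Cm + 1) by rewrite divr_gt0// ltr_wpDl.
have [k Hk] := population_small hs01 hV hT psi0 psiQ e0'.
exists k; apply: le_trans (limit_var hs01 hV hT muE h0 hQ k measurable_functional partial_sum_cvg) _.
rewrite lee_fin; apply: le_trans (ler_generation_mean W N k hC) _.
rewrite /generation_mean.
under eq_bigr => v _.
  rewrite bounded_meanZ; last exact: (bounded_var_count W N n v (fun a => (0 < a)%N%:R)).
  over.
rewrite -mulr_sumr; apply: le_trans (ler_wpM2l Cm0 (ltW Hk)) _.
rewrite mulrA ler_pdivrMr; last by rewrite ltr_wpDl.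
by rewrite mulrC ler_pM2l// lerDl.
Qed.

Lemma mean_partial_sum k : \int[P]_x M k x = mu n.
Proof.
have bM j := bounded_var_partial_sum W N n toll mu j.
have bM0 : bounded_var (fun x => M k x - M 0 x).
  apply: bounded_varD => //; under eq_fun do rewrite -mulN1r.
  by apply: bounded_varM => //; exact: bounded_var_cst.
have -> : \int[P]_x M k x = \int[P]_x ((M k x - M 0 x) + mu n).
  by apply: eq_Rintegral => x _; rewrite [M 0 x](partial_sum0 hT) subrK.
rewrite bounded_meanD//; last exact: bounded_var_cst.
rewrite (bounded_mean_cst P (mu n)).
under eq_Rintegral do rewrite (partial_sum_diff N n toll mu 0 k).
pose xi a l := toll a l + \sum_i mu (l i) - mu a.
rewrite bounded_mean_sum; last by move=> v; exact: (bounded_var_state W N n v xi).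
rewrite big1 ?add0r// => v _; rewrite (mean_state hs01 hV hT v xi).
rewrite -[RHS](bounded_mean_cst P 0); apply: eq_Rintegral => x _.
rewrite /xi offspring_meanD// -muE ?count_le//.
by rewrite (offspring_mean_cst s s0 s1 V _ (- mu (C v x))) subrr.
Qed.

(** The functional is the limit in mean square, hence in mean, of variables with
    mean [mu n]. *)
Lemma functional_mean : P.-integrable setT (EFin \o X) /\ \int[P]_x X x = mu n.
Proof.
have mX := measurable_functional.
have bM k := bounded_var_partial_sum W N n toll mu k.
have mD k : measurable_fun setT (fun x => X x - M k x).
  by apply: measurable_funB => //; exact: (bM k).1.
(* passes from mean square to mean without Hoelder's inequality *)
have abs_bound (e y : R) : 0 < e -> `|y| <= e + e^-1 * y ^+ 2.
  move=> e0; rewrite -[y ^+ 2]real_normK ?num_real//; set z := `|y|.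
  have [ze|ez] := leP z e; first by rewrite ler_wpDr// mulr_ge0 ?sqr_ge0// invr_ge0 ltW.
  rewrite ler_wpDl ?(ltW e0)// expr2 mulrA ler_peMl ?normr_ge0//.
  by rewrite mulrC ler_pdivlMr// mul1r ltW.
have int_bound e k : 0 < e -> (\int[P]_x ((X x - M k x) ^+ 2)%:E <= (e * e)%:E)%E ->
    (\int[P]_x `|(X x - M k x)%:E| <= (e + e)%:E)%E.
  move=> e0 He.
  apply: (@le_trans _ _ (\int[P]_x (e%:E + (e^-1)%:E * ((X x - M k x) ^+ 2)%:E)))%E.
    apply: ge0_le_integral => //.
    - by apply: measurableT_comp => //; exact/measurable_EFinP.
    - by apply/measurable_EFinP; apply: measurable_funD => //; apply: measurable_funM => //; exact: measurable_funX.
    - by move=> x _; rewrite -EFinM -EFinD lee_fin abs_bound.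
  rewrite ge0_integralD//; last 3 first.
  - by move=> x _; rewrite lee_fin ltW.
  - by move=> x _; rewrite -EFinM lee_fin mulr_ge0 ?sqr_ge0// invr_ge0 ltW.
  - by apply/measurable_EFinP; apply: measurable_funM => //; exact: measurable_funX.
  rewrite integral_cst// ge0_integralZl_EFin//; last 3 first.
  - by move=> x _; rewrite lee_fin sqr_ge0.
  - by apply/measurable_EFinP; exact: measurable_funX.
  - by rewrite invr_ge0 ltW.
  have /= -> := probability_setT P; rewrite mule1 EFinD leeD2l//.
  apply: (@le_trans _ _ ((e^-1)%:E * (e * e)%:E)%E).
    by rewrite lee_pmul2l// lte_fin invr_gt0.
  by rewrite -EFinM mulrA mulVf ?gt_eqF// mul1r.
have iD k e : 0 < e -> (\int[P]_x ((X x - M k x) ^+ 2)%:E <= (e * e)%:E)%E ->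
    P.-integrable setT (EFin \o (fun x => X x - M k x)).
  move=> e0 He; apply/integrableP; split; first exact/measurable_EFinP.
  by apply: le_lt_trans (int_bound _ _ e0 He) (ltry _).
have iX : P.-integrable setT (EFin \o X).
  have [k Hk] := functional_approx (mulr_gt0 (@ltr01 R) (@ltr01 R)).
  have := integrableD measurableT (iD _ _ ltr01 Hk) (bounded_var_integrable P (bM k)).
  by apply: eq_integrable => // x _ /=; rewrite -EFinD subrK.
split=> //.
suff H e : 0 < e -> `|\int[P]_x X x - mu n| <= e.
  apply/eqP; rewrite -subr_eq0 -normr_le0; apply/ler_addgt0Pl => e e0.
  by rewrite addr0; exact: H.
move=> e0; have e20 : 0 < e / 2 by rewrite divr_gt0.
have [k Hk] := functional_approx (mulr_gt0 e20 e20).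
have iDk := iD _ _ e20 Hk.
have -> : \int[P]_x X x - mu n = \int[P]_x (X x - M k x).
  by rewrite RintegralB//; [rewrite -(mean_partial_sum k)|exact: bounded_var_integrable].
apply: le_trans (le_normr_Rintegral measurableT iDk) _.
rewrite -lee_fin [e]splitr; apply: le_trans (int_bound _ _ e20 Hk).
rewrite /Rintegral fineK//.
have /integrableP[mf ifin] := iDk; rewrite ge0_fin_numE//.
by apply: integral_ge0 => x _; rewrite lee_fin.
Qed.

End mean_variance.
End functional.

(** * Asymptotics of the variance *)
Section toll_moment.
Context (R : realType) (b s s0 s1 : nat) (hs01 : (b * s1 + s0 <= s.+1)%N)
  (d0 : measure_display) (Om0 : measurableType d0) (P0 : probability Om0 R)
  (V : 'I_b -> {RV P0 >-> R}).
Hypothesis hV : forall x, (forall i, 0 <= V i x) /\ \sum_(i < b) V i x <= 1.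
Context (d : measure_display) (Om : measurableType d) (P : probability Om R)
  (W : node b -> 'I_b -> {RV P >-> R}) (N : node b -> {RV P >-> nat}) (n : nat).
Hypothesis hT : is_split_tree V W N s s0 s1 n.
Variables (phi : counts b -> R) (f : {ffun 'I_b -> nat} -> R).
Hypothesis phif : forall t : counts b,
  ball_tree s t -> (0 < t [::])%N -> phi t = f [ffun i => t [:: i]].

Lemma toll_second_moment : (0 < n)%N ->
  ('E_P[fun x => (phi (fun v => N v x) ^+ 2)%R])%E =
  (offspring_mean s s0 s1 V n (fun l => f l ^+ 2))%:E.
Proof.
move=> n0; have [root tree _] := hT.
have phiE x : phi (fun v => N v x) = toll f (N [::] x) (raw_children N [::] x).
  by rewrite phif ?root// /toll n0; congr (f _).
rewrite unlock; transitivity (\int[P]_x (f (children N n [::] x) ^+ 2)%:E)%E; last first.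
  have bv : bounded_var (fun x => f (children N n [::] x) ^+ 2).
    exact: (bounded_var_state W N n [::] (fun _ l => f l ^+ 2)).
  rewrite bounded_var_EFin//; congr EFin.
  rewrite (mean_state hs01 hV hT [::] (fun _ l => f l ^+ 2)).
  under eq_Rintegral => x _ do rewrite (count_root hT).
  exact: (bounded_mean_cst P (offspring_mean s s0 s1 V n (fun l => f l ^+ 2))).
apply: ae_eq_integral => //.
- apply/measurable_EFinP; apply: measurable_funX => _ B mB; rewrite setTI.
  under [X in measurable (X @^-1` _)]eq_fun do rewrite phiE.
  exact: (measurable_node_toll N f [::] B).
- apply/measurable_EFinP.
  exact: (bounded_var_state W N n [::] (fun _ l => f l ^+ 2)).1.
- apply: filterS (count_ae hs01 hV hT) => x HC _; congr (_ ^+ 2)%:E.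
  rewrite phiE /toll root n0; congr (f _).
  by apply/ffunP => i; rewrite !ffunE HC.
Qed.

End toll_moment.

Section asymptotics.
Context (R : realType) (b s s0 s1 : nat) (hs01 : (b * s1 + s0 <= s.+1)%N)
  (hs : (1 <= s)%N) (hb : (2 <= b)%N)
  (d0 : measure_display) (Om0 : measurableType d0) (P0 : probability Om0 R)
  (V : 'I_b -> {RV P0 >-> R}).
Hypothesis hV : forall x, (forall i, 0 <= V i x) /\ \sum_(i < b) V i x <= 1.
Hypothesis hV1 : (P0 [set x | order_stat V 0 x = 1%R] < 1)%E.
Variables (beta : R) (beta0 : 0 < beta) (beta1 : beta <= 1).
Hypothesis hVbeta : {ae P0, forall x, \sum_(i < b) (V i x) `^ beta = 1}.
Implicit Types (g : {ffun 'I_b -> nat} -> R) (l : {ffun 'I_b -> nat}).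
Local Notation Q := (offspring_mean s s0 s1 V).

Lemma powR_dominates (K e gam : R) : 0 < e -> 0 < gam ->
  exists A : nat, forall a, (A <= a)%N -> K <= e * a%:R `^ gam.
Proof.
move=> e0 g0; pose c := (`|K| / e) `^ gam^-1.
have c0 : 0 <= c by exact: powR_ge0.
exists (Num.bound c) => a ca.
have ca' : c <= a%:R.
  by apply: le_trans (ltW (archi_boundP c0)) _; rewrite ler_nat.
apply: le_trans (ler_norm _) _; rewrite mulrC -ler_pdivrMr//.
have <- : c `^ gam = `|K| / e.
  by rewrite /c -powRrM mulVf ?gt_eqF// powRr1// divr_ge0// ltW.
by rewrite ge0_ler_powR ?nnegrE// ltW.
Qed.

Variables (w : R -> R) (B : R).
Hypothesis wB : forall x, `|w x| <= B.
Hypothesis wu : forall e, 0 < e ->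
  exists2 dl, 0 < dl & forall x y, `|x - y| < dl -> `|w x - w y| <= e.
Hypothesis wV : {ae P0, forall x, forall i, 0 < V i x -> forall t, w (t + ln (V i x)) = w t}.
Variable mu : nat -> R.
Hypothesis mu0 : mu 0%N = 0.
Hypothesis muw : forall e, 0 < e -> exists A : nat, forall a, (A <= a)%N ->
  `|mu a - w (ln a%:R) * a%:R `^ beta| <= e * a%:R `^ beta.

Let H (a : nat) (y : R) := w (ln a%:R + ln y) * y `^ beta.

(** Scaling by the count [a] of the parent; the case [j = 0] uses that
    [0 ^ beta = 0]. *)
Lemma profile_ratio (a j : nat) : (0 < a)%N ->
  w (ln j%:R) * j%:R `^ beta = a%:R `^ beta * H a (j%:R / a%:R).
Proof.
move=> a0; have aR : 0 < a%:R :> R by rewrite ltr0n.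
case: j => [|j]; first by rewrite /H mul0r powR0 ?gt_eqF// !mulr0.
have lR : 0 < j.+1%:R :> R by rewrite ltr0n.
rewrite /H mulrCA -powRM ?divr_ge0// ?ltW//; congr (w _ * _ `^ _).
  by rewrite -lnM ?posrE ?divr_gt0// mulrC divfK ?gt_eqF.
by rewrite mulrC divfK ?gt_eqF.
Qed.

(** The core of the proof, on the event that the split vector is [p].  Replace
    [mu j] by [varpi (ln j) j^beta], up to [e1 j^beta + Ce]; replace [l i] by
    [a * p i], up to [e1 + K (l i / a - p i)^2] relative to [T = a^beta]; then
    the sum over [i] is [varpi (ln a) T], as [\sum_i (p i)^beta = 1] and [varpi]
    is invariant under translation by [ln (p i)].  The quadratic terms have mean
    [O (1 / a)] by [offspring_lln]. *)
Lemma mean_increment_small (e : R) : 0 < e ->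
  exists A : nat, (s < A)%N /\ forall a, (A <= a)%N ->
    Q a (fun l => (\sum_i mu (l i) - mu a) ^+ 2) <= e * (a%:R `^ beta) ^+ 2.
Proof.
move=> e0.
have b0 : 0 < b%:R :> R by rewrite ltr0n (ltn_trans _ hb).
(* each child contributes three errors [e1], and the parent one *)
pose M : R := 3 * b%:R + 1.
have M0 : 0 < M by rewrite ltr_wpDl// mulr_ge0// ltW.
pose e1 := Num.sqrt (e / 4) / M.
have e10 : 0 < e1 by rewrite divr_gt0// sqrtr_gt0 divr_gt0.
have Me1 : (M * e1) ^+ 2 = e / 4.
  by rewrite /e1 mulrC divfK ?gt_eqF// sqr_sqrtr// divr_ge0// ltW.
have [A1 HA1] := muw e10.
have [K K0 HK] := log_periodic_modulus beta0 wB wu e10.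
pose Ce := \sum_(a < A1) `|mu a - w (ln a%:R) * a%:R `^ beta|.
have HCe (j : nat) : `|mu j - w (ln j%:R) * j%:R `^ beta| <= e1 * j%:R `^ beta + Ce.
  have Ce0 : 0 <= Ce by rewrite sumr_ge0.
  have [Al|lA] := leqP A1 j; first by rewrite ler_wpDr// HA1.
  apply: ler_wpDl; first by rewrite mulr_ge0 ?powR_ge0// ltW.
  by rewrite /Ce (bigD1 (Ordinal lA))//= lerDl sumr_ge0.
have [A2 HA2] := powR_dominates Ce e10 beta0.
pose c : R := 2 + 2 * (s0 + b * s1 + s1)%:R ^+ 2.
have c0 : 0 <= c by rewrite addr_ge0// mulr_ge0// sqr_ge0.
have e20 : 0 < e / 2 by rewrite divr_gt0.
have [A3 HA3] := powR_dominates (2 * K ^+ 2 * b%:R ^+ 2 * c) e20 ltr01.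
exists (maxn s.+1 (maxn A1 (maxn A2 A3))); split; first by rewrite leq_max leqnn.
move=> a; rewrite !geq_max => /and4P[sa a1 a2 a3].
have a0 : (0 < a)%N by apply: leq_ltn_trans sa.
have aR : 0 < a%:R :> R by rewrite ltr0n.
set T := a%:R `^ beta; have T0 : 0 <= T by exact: powR_ge0.
have {HA2}CeT : Ce <= e1 * T by exact: HA2.
have {HA3}Ka : 2 * K ^+ 2 * b%:R ^+ 2 * (c / a%:R) <= e / 2.
  by rewrite mulrA ler_pdivrMr//; have := HA3 _ a3; rewrite powRr1// ltW.
apply: offspring_mean_le_ae => //.
apply: filterS2 wV hVbeta => x wVx Vb.
have [p0 p1] := hV x; set p := fun i => V i x.
pose D l i := ((l i)%:R / a%:R - p i) ^+ 2 : R.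
apply: (@le_trans _ _ (offspring_exp s s0 s1 a p (fun l =>
  T ^+ 2 * (e / 2) + \sum_i (T ^+ 2 * (2 * K ^+ 2 * b%:R)) * D l i))); last first.
  rewrite offspring_expD offspring_exp_cst offspring_exp_sum.
  have -> : e * T ^+ 2 = T ^+ 2 * (e / 2) + T ^+ 2 * (e / 2) by field.
  rewrite lerD2l.
  apply: (@le_trans _ _ (\sum_(i < b) (T ^+ 2 * (2 * K ^+ 2 * b%:R)) * (c / a%:R))).
    apply: ler_sum => i _; rewrite offspring_expZ ler_wpM2l//.
      by rewrite mulr_ge0 ?sqr_ge0// mulr_ge0 ?mulr_ge0 ?sqr_ge0// ltW.
    exact: offspring_lln.
  rewrite sumr_const card_ord -[leLHS]mulr_natr.
  have -> : T ^+ 2 * (2 * K ^+ 2 * b%:R) * (c / a%:R) * b%:R =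
    T ^+ 2 * (2 * K ^+ 2 * b%:R ^+ 2 * (c / a%:R)) by ring.
  by rewrite ler_wpM2l ?sqr_ge0.
apply: ler_offspring_exp => // l la.
have D01 i : 0 <= D l i <= 1.
  rewrite sqr_ge0/=; have /andP[q0 q1] := proportion_itv01 R i a0 la.
  have pp0 : 0 <= p i := p0 i; have pp1 : p i <= 1 by exact: (simplex_le1 p0 p1).
  rewrite /D -real_normK ?num_real// expr_le1// ler_norml.
  by move: (p i) ((l i)%:R / a%:R) pp0 pp1 q0 q1 => y z *; apply/andP; split; lra.
set SD := \sum_i D l i.
have SD0 : 0 <= SD by apply: sumr_ge0 => i _; case/andP: (D01 i).
have SDb : SD <= b%:R.
  rewrite /SD; apply: (@le_trans _ _ (\sum_(i < b) 1)); last by rewrite sumr_const card_ord.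
  by apply: ler_sum => i _; case/andP: (D01 i).
suff Zb : `|\sum_i mu (l i) - mu a| <= T * (M * e1 + K * SD).
  rewrite -real_normK ?num_real//.
  apply: (@le_trans _ _ ((T * (M * e1 + K * SD)) ^+ 2)).
    by rewrite lerXn2r// nnegrE// (le_trans _ Zb).
  rewrite exprMn -mulr_sumr -/SD -[X in _ <= _ + X]mulrA -mulrDr ler_wpM2l ?sqr_ge0//.
  apply: (@le_trans _ _ (2 * (M * e1) ^+ 2 + 2 * (K * SD) ^+ 2)).
    have := sqr_ge0 (M * e1 - K * SD); rewrite -subr_ge0 => h.
    rewrite -subr_ge0; apply: le_trans h _; rewrite le_eqVlt; apply/orP; left; apply/eqP; ring.
  rewrite Me1; apply: lerD.
    by rewrite le_eqVlt; apply/orP; left; apply/eqP; field.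
  rewrite exprMn.
  have -> : 2 * K ^+ 2 * b%:R * SD = 2 * (K ^+ 2 * (b%:R * SD)) by ring.
  by rewrite ler_pM2l// ler_wpM2l ?sqr_ge0// expr2 ler_wpM2r.
have HaV : \sum_i H a (p i) = w (ln a%:R).
  rewrite -[RHS]mulr1 -[X in _ = _ * X]Vb mulr_sumr; apply: eq_bigr => i _.
  have := p0 i; rewrite le_eqVlt => /predU1P[pi0|pi].
    by rewrite /H /p -pi0 powR0 ?gt_eqF// !mulr0.
  by rewrite /H /p wVx.
have -> : \sum_i mu (l i) - mu a =
    \sum_i ((mu (l i) - w (ln (l i)%:R) * (l i)%:R `^ beta) +
            T * (H a ((l i)%:R / a%:R) - H a (p i))) + (w (ln a%:R) * T - mu a).
  under [X in _ = X + _]eq_bigr => i _ do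
    rewrite (profile_ratio (l i) a0) mulrBr addrA subrK.
  rewrite sumrB -mulr_sumr HaV /T; ring.
apply: le_trans (ler_normD _ _) _.
apply: (@le_trans _ _ (\sum_(i < b) (2 * e1 * T + T * (e1 + K * D l i)) + e1 * T)).
  apply: lerD; last by rewrite distrC; apply: HA1.
  apply: le_trans (ler_norm_sum _ _ _) _; apply: ler_sum => i _.
  apply: le_trans (ler_normD _ _) _; apply: lerD.
    apply: le_trans (HCe _) _.
    have -> : 2 * e1 * T = e1 * T + e1 * T by ring.
    apply: lerD => //; rewrite ler_pM2l//.
    apply: ge0_ler_powR; rewrite ?nnegrE//; first exact: ltW.
    by rewrite ler_nat (leq_trans _ la)// (bigD1 i)//= leq_addr.
  rewrite normrM ger0_norm// ler_wpM2l//; apply: HK.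
    exact: proportion_itv01.
  by rewrite p0 (simplex_le1 p0 p1).
rewrite le_eqVlt; apply/orP; left; apply/eqP.
rewrite big_split/= sumr_const card_ord -[_ *+ b]mulr_natr -mulr_sumr big_split/=.
rewrite sumr_const card_ord -[e1 *+ b]mulr_natr -mulr_sumr -/SD /M; ring.
Qed.

Variable (f : {ffun 'I_b -> nat} -> R).
Variables (delta C : R).
Hypothesis delta0 : 0 < delta.
Hypothesis fC : forall a, (1 <= a)%N ->
  Q a (fun l => f l ^+ 2) <= C * a%:R `^ (2 * (beta - delta)).

Lemma powR_double (a : nat) : a%:R `^ (2 * beta) = (a%:R `^ beta) ^+ 2 :> R.
Proof. by rewrite mulrC powRrM powR_mulrn ?powR_ge0. Qed.

Lemma toll_variance_small (e : R) : 0 < e ->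
  exists A : nat, (0 < A)%N /\ forall a, (A <= a)%N ->
    Q a (fun l => (toll f a l + \sum_i mu (l i) - mu a) ^+ 2) <= e * a%:R `^ (2 * beta).
Proof.
move=> e0; have e40 : 0 < e / 4 by rewrite divr_gt0.
have d20 : 0 < 2 * delta by rewrite mulr_gt0.
have [A1 [sA1 HA1]] := mean_increment_small e40.
have [A2 HA2] := powR_dominates (2 * C) (divr_gt0 e0 (@ltr0Sn R 1)) d20.
exists (maxn A1 A2); split; first by rewrite leq_max (leq_ltn_trans _ sA1).
move=> a; rewrite geq_max => /andP[a1 a2].
have a0 : (0 < a)%N by apply: leq_trans a1; apply: leq_ltn_trans sA1.
have aR : 0 < a%:R :> R by rewrite ltr0n.
apply: (@le_trans _ _ (Q a (fun l => 2 * f l ^+ 2 + 2 * (\sum_i mu (l i) - mu a) ^+ 2))).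
  apply: ler_offspring_mean => // l _; rewrite /toll a0.
  set y := f l; set z := \sum_i _ - _.
  have -> : y + \sum_i mu (l i) - mu a = y + z by rewrite /z addrA.
  by have := sqr_ge0 (y - z); rewrite !expr2; nra.
rewrite offspring_meanD// !offspring_meanZ//.
have := HA1 _ a1; rewrite -powR_double => h1.
have h2 : 2 * Q a (fun l => f l ^+ 2) <= e / 2 * a%:R `^ (2 * beta).
  have -> : 2 * beta = 2 * delta + 2 * (beta - delta) by ring.
  rewrite powRD; last by rewrite (gt_eqF aR) implybT.
  apply: le_trans (_ : 2 * (C * a%:R `^ (2 * (beta - delta))) <= _).
    by rewrite ler_pM2l// fC.
  by rewrite !mulrA ler_wpM2r ?powR_ge0// HA2.
lra.
Qed.

(** For large [a] the gain of [a^(2 beta)] in a split covers the variance, by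
    [toll_variance_small]; the finitely many other counts are covered by the
    unit gain of [C' * psi], where [psi a = O (a^(3 beta / 2))]. *)
Lemma variance_majorant (e : R) : 0 < e ->
  exists h : nat -> R, [/\ forall a, 0 <= h a,
    forall a, Q a (fun l => (toll f a l + \sum_i mu (l i) - mu a) ^+ 2) +
       Q a (fun l => \sum_i h (l i)) <= h a
    & exists A : nat, forall a, (A <= a)%N -> h a <= e * a%:R `^ (2 * beta)].
Proof.
move=> e0; have e20 : 0 < e / 2 by rewrite divr_gt0.
have b2 : beta < 2 * beta by rewrite ltr_pMl// ltr1n.
have b3 : beta < 3 / 2 * beta by rewrite ltr_pMl//; lra.
have [kap [k1 [A1 HA1]]] := offspring_power_contraction hs01 hb hV hV1 beta0 hVbeta b2.
have [psi [Cp [Cp0 psiC psiQ]]] := size_bound hs01 hs hb hV hV1 beta0 beta1 hVbeta b3.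
have ek : 0 < e / 2 * (1 - kap) by rewrite mulr_gt0// subr_gt0.
have [A2 [A20 HA2]] := toll_variance_small ek.
pose sig a := Q a (fun l => (toll f a l + \sum_i mu (l i) - mu a) ^+ 2).
pose pw a := Q a (fun l => \sum_i (l i)%:R `^ (2 * beta)).
have Qge0 a g : (forall l, 0 <= g l) -> 0 <= Q a g.
  move=> g0; rewrite -[leLHS](offspring_mean_cst s s0 s1 V a 0).
  by apply: ler_offspring_mean => // l _; exact: g0.
have sig0 a : 0 <= sig a by apply: Qge0 => l; exact: sqr_ge0.
have pw0 a : 0 <= pw a by apply: Qge0 => l; apply: sumr_ge0 => i _; exact: powR_ge0.
pose A := maxn A1 A2.
pose C' := \sum_(a < A) (sig a + e / 2 * pw a).
have t0 a : 0 <= sig a + e / 2 * pw a by rewrite addr_ge0// mulr_ge0// ltW.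
have C'0 : 0 <= C' by apply: sumr_ge0 => a _; exact: t0.
pose h a := e / 2 * a%:R `^ (2 * beta) + C' * psi a.
have psi0 a : 0 <= psi a by case/andP: (psiC a).
exists h; split.
- by move=> a; rewrite addr_ge0 ?mulr_ge0 ?powR_ge0// ltW.
- move=> a.
  rewrite (@eq_offspring_mean _ _ _ _ _ hs01 _ _ _ _ hV _ (fun l => \sum_i h (l i))
     (fun l => e / 2 * (\sum_i (l i)%:R `^ (2 * beta)) + C' * \sum_i psi (l i))); last first.
    by move=> l _; rewrite !mulr_sumr -big_split.
  rewrite offspring_meanD// !offspring_meanZ// -/(pw a) -/(sig a).
  have psia := psiQ a.
  have [Aa|aA] := leqP A a.
    have [a1 a2] : (A1 <= a)%N /\ (A2 <= a)%N by apply/andP; rewrite -geq_max.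
    have a0 : (0 < a)%N by apply: leq_trans a2.
    have h1 := HA1 _ a1; have h2 := HA2 _ a2.
    rewrite a0 -/(pw a) in psia h1 *; rewrite -/(sig a) in h2.
    have h3 : e / 2 * pw a <= e / 2 * (kap * a%:R `^ (2 * beta)) by rewrite ler_pM2l.
    have h4 : C' * Q a (fun l => \sum_i psi (l i)) <= C' * psi a.
      by rewrite ler_wpM2l// (le_trans _ psia)// lerDr ler01.
    rewrite /h addrA; apply: lerD => //.
    have : e / 2 * (1 - kap) * a%:R `^ (2 * beta) + e / 2 * (kap * a%:R `^ (2 * beta)) = e / 2 * a%:R `^ (2 * beta) by ring.
    by move=> <-; apply: lerD.
  case: a aA psia => [_|a aA] psia.
    have -> : sig 0%N = 0.
      rewrite /sig offspring_mean_leaf// /toll/= mu0 subr0 add0r big1 ?expr0n//.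
      by move=> i _; rewrite ffunE.
    have -> : pw 0%N = 0.
      rewrite /pw (@offspring_mean_empty _ _ _ _ _ _ _ _ _ (fun a => a%:R `^ (2 * beta)))//.
      by rewrite powR0// gt_eqF// mulr_gt0.
    rewrite mulr0 !add0r /h; apply: ler_wpDl; first by rewrite mulr_ge0 ?powR_ge0// ltW.
    by rewrite ler_wpM2l// (le_trans _ psia)// lerDr.
  have tC : sig a.+1 + e / 2 * pw a.+1 <= C'.
    by rewrite /C' (bigD1 (Ordinal aA))//= lerDl sumr_ge0// => i _; exact: t0.
  have h4 := ler_wpM2l C'0 psia; rewrite mulrDr mulr1 in h4.
  have h5 : 0 <= e / 2 * a.+1%:R `^ (2 * beta) by rewrite mulr_ge0 ?powR_ge0// ltW.
  rewrite /h; lra.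
- have bh : 0 < beta / 2 by rewrite divr_gt0.
  have [A3 HA3] := powR_dominates (C' * Cp) e20 bh.
  exists (maxn 1 A3) => a; rewrite geq_max => /andP[a0 a3].
  have aR : 0 < a%:R :> R by rewrite ltr0n.
  have -> : e * a%:R `^ (2 * beta) = e / 2 * a%:R `^ (2 * beta) + e / 2 * a%:R `^ (2 * beta) by field.
  rewrite /h lerD2l.
  apply: (@le_trans _ _ (C' * (Cp * a%:R `^ (3 / 2 * beta)))).
    by rewrite ler_wpM2l//; case/andP: (psiC a).
  have -> : 2 * beta = beta / 2 + 3 / 2 * beta by field.
  rewrite powRD; last by rewrite (gt_eqF aR) implybT.
  by rewrite !mulrA ler_wpM2r ?powR_ge0// HA3.
Qed.

End asymptotics.

(** * Periodicity and the lattice of ln V *)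
Section periodic_functions.
Variables (R : realType) (w : R -> R) (d : R).
Hypothesis wd : periodic w d.

Lemma periodic_int (z : int) t : w (t + d * z%:~R) = w t.
Proof.
case: z => k; first by rewrite -pmulrn mulr_natr periodicn.
rewrite NegzE mulrNz mulrN -pmulrn mulr_natr.
by rewrite -(periodicn wd k.+1) subrK.
Qed.

(** Heine's argument on the compact segment [0, d], for increments leaving it
    too; translation by a multiple of [d] brings any point into the segment. *)
Lemma periodic_unif_continuous : 0 < d -> continuous w ->
  forall e, 0 < e -> exists2 dl, 0 < dl & forall x y, `|x - y| < dl -> `|w x - w y| <= e.
Proof.
move=> d0 cw e e0.
have e20 : 0 < e / 2 by rewrite divr_gt0.
pose Pr (h x : R) := forall y, `|x - y| < h -> `|w x - w y| <= e.
have : \forall h \near 0^'+, `[0, d]%classic `<=` Pr h.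
  have /compact_near_coveringP := @segment_compact R 0 d.
  apply=> x _.
  have /nbhs_ballP[r /= r0 Hr] : \forall z \near x, `|w x - w z| < e / 2.
    by move: (cw x) => /cvgrPdist_lt; apply.
  exists (ball x (r / 2), [set h | h < r / 2]) => /=.
    split; first by apply: nbhsx_ballx; rewrite divr_gt0.
    by apply: nbhs_right_lt; rewrite divr_gt0.
  move=> [x' h] /= [xx' hr] y x'y; rewrite [e]splitr.
  have -> : w x' - w y = (w x' - w x) + (w x - w y) by ring.
  apply: le_trans (ler_normD _ _) _; apply: lerD.
    rewrite distrC ltW//; apply: Hr; apply: lt_trans xx' _.
    by rewrite ltr_pdivrMr// ltr_pMr// ltr1n.
  rewrite ltW//; apply: Hr; rewrite /ball/=.
  have -> : x - y = (x - x') + (x' - y) by ring.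
  apply: le_lt_trans (ler_normD _ _) _; rewrite [r]splitr ltrD//.
  exact: lt_trans hr.
move=> H; have [h [h0 Hh]] := filter_ex (filterI (nbhs_right_gt (0 : R)) H).
exists h => // x y xy.
pose z : int := - Num.floor (x / d).
rewrite -(periodic_int z x) -(periodic_int z y); apply: Hh; last first.
  by rewrite [X in `|X|](_ : _ = x - y); last ring.
rewrite /= in_itv/= /z mulrNz mulrN.
have /andP[h1 h2] := floor_itv (x / d).
have h3 : d * (Num.floor (x / d))%:~R <= x by rewrite mulrC -ler_pdivlMr.
have h4 : x <= d * (Num.floor (x / d))%:~R + d.
  rewrite intrD1 ltr_pdivrMr// in h2.
  by apply: le_trans (ltW h2) _; rewrite mulrDl mul1r mulrC.
by apply/andP; split; lra.
Qed.

End periodic_functions.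

Section lattice.
Context (R : realType) (b : nat) (hb : (0 < b)%N) (d0 : measure_display)
  (Om0 : measurableType d0) (P0 : probability Om0 R) (V : 'I_b -> {RV P0 >-> R}).

(** The law of [V_I] gives weight [1 / b] to each component, so a null set for it
    is null for every component. *)
Lemma lattice_span_ae (d : R) : lattice_span V d ->
  {ae P0, forall x, forall i, 0 < V i x -> exists z : int, ln (V i x) = d * z%:~R}.
Proof.
move=> [_]; set bad := [set x | _] => Hbad.
have mbad : measurable bad.
  have -> : bad = `]0, +oo[%classic `\` \bigcup_(z in [set: int]) [set expR (d * z%:~R)].
    apply/seteqP; split => x /=.
      move=> [x0 nz]; split; first by rewrite in_itv/= x0.
      by move=> [z _ /= xE]; apply: nz; exists z; rewrite xE expRK.
    rewrite in_itv/= andbT => -[x0 nz]; split => // -[z lz]; apply: nz; exists z => //=.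
    by rewrite -lz lnK// posrE.
  apply: measurableD; first exact: measurable_itv.
  by apply: countable_bigcupT_measurable => // z; exact: measurable_set1.
apply: filter_forall => i.
have : P0 (V i @^-1` bad) = 0%E.
  apply/eqP; rewrite eq_le measure_ge0 andbT.
  have b0 : 0 < b%:R^-1 :> R by rewrite invr_gt0 ltr0n.
  have : ((b%:R^-1)%:E * P0 (V i @^-1` bad) <= 0)%E.
    rewrite -Hbad /law_VI (bigD1 i)//= leeDl// sume_ge0// => j _.
    by rewrite mule_ge0// lee_fin ltW.
  by rewrite pmule_rle0.
move=> PB; exists (V i @^-1` bad); split => //; first exact: measurable_funPTI.
move=> x /= nH; apply: contrapT => nb; apply: nH => Vi; apply: contrapT => nz.
exact: nb.
Qed.

End lattice.

(** * The theorem *)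
Lemma L2_norm_le (R : realType) (d : measure_display) (Om : measurableType d)
  (P : probability Om R) (Y : Om -> R) (e : R) : 0 <= e -> measurable_fun setT Y ->
  (\int[P]_x ((Y x) ^+ 2)%:E <= (e ^+ 2)%:E)%E ->
  Y \in Lfun P 2%:E /\ ('N[P]_2%:E[EFin \o Y] <= e%:E)%E.
Proof.
move=> e0 mY iY.
have N2 : ('N[P]_2%:E[EFin \o Y] <= e%:E)%E.
  rewrite unlock.
  have -> : e%:E = poweR (e ^+ 2)%:E 2^-1.
    apply/esym; etransitivity; first exact: (poweR_EFin (e ^+ 2) 2^-1).
    by rewrite powR12_sqrt ?sqr_ge0// sqrtr_sqr ger0_norm.
  have E : (\int[P]_x `|(EFin \o Y) x| `^ 2 = \int[P]_x ((Y x) ^+ 2)%:E)%E.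
    apply: eq_integral => x _ /=.
    etransitivity; first exact: (poweR_EFin `|Y x| 2).
    by rewrite powR_mulrn// real_normK ?num_real.
  rewrite E gt0_ler_poweR//.
  - by rewrite in_itv/= leey integral_ge0// => x _; rewrite lee_fin sqr_ge0.
  - by rewrite in_itv/= leey lee_fin sqr_ge0.
split=> //; rewrite inE; apply/andP; split; rewrite inE//=.
exact: le_lt_trans N2 (ltry _).
Qed.

Unset Implicit Arguments.

Theorem corollary2p3 (R : realType) (b s s0 s1 : nat)
  (hb : (2 <= b)%N) (hs : (1 <= s)%N) (hs01 : (b * s1 + s0 <= s.+1)%N)
  (* the split vector *)
  (d0 : measure_display) (Om0 : measurableType d0) (P0 : probability Om0 R)
  (V : 'I_b -> {RV P0 >-> R}) (hV : split_vector_axioms V)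
  (beta d : R) (hbeta : is_beta V beta) (hd : is_span V d)
  (* the trees T_n, n >= 1 *)
  (dOm : measure_display) (Om : measurableType dOm) (P : probability Om R)
  (W : nat -> node b -> 'I_b -> {RV P >-> R})
  (N : nat -> node b -> {RV P >-> nat})
  (hT : forall n, (1 <= n)%N -> is_split_tree V (W n) (N n) s s0 s1 n)
  (* the toll function *)
  (phi : counts b -> R) (hphi : toll_of_children s phi)
  (hphi2 : exists delta C : R, 0 < delta /\
     forall n, (1 <= n)%N ->
       ('E_P[fun x => (phi (fun v => N n v x) ^+ 2)%R]
        <= (C * n%:R `^ (2 * (beta - delta)))%R%:E)%E)
  (X : nat -> Om -> R)
  (hX : forall n x, X n x = additive_functional phi (fun v => N n v x))
  (varpi : R -> R) (hvarpi : is_varpi d beta (fun n => 'E_P[X n])%E varpi)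
  (hvarpi0 : exists2 c : R, 0 < c & forall x, c <= `|varpi x|)
  (hV1 : {ae P0, forall x, \sum_(i < b) (V i x) `^ beta = 1}) :
  cvg0_L2 P (fun n x =>
    (X n x - fine ('E_P[X n])%E) / (n%:R `^ beta * varpi (ln n%:R))).
Proof.
have [hVs hV0 _ _] := hV; have [/andP[beta0 beta1] _] := hbeta.
have [f phif] := hphi; have [delta [C [delta0 hC]]] := hphi2.
have [[B0 [_ HB0]] cw [wper wconst] _ muo] := hvarpi.
have [c c0 wc] := hvarpi0.
have XE n : X n = fun x => additive_functional phi (fun v => N n v x).
  exact/funext.
pose mu n := if n == 0%N then 0 else fine ('E_P[X n])%E.
have b2 : beta < 2 * beta by rewrite ltr_pMl// ltr1n.
have [psi [Cp [Cp0 psiC psiQ]]] := size_bound hs01 hs hb hVs hV0 beta0 beta1 hV1 b2.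
have psi0 a : 0 <= psi a by case/andP: (psiC a).
have psi00 : psi 0%N = 0.
  apply/eqP; rewrite eq_le psi0 andbT; case/andP: (psiC 0%N) => _.
  by rewrite powR0 ?mulr0// gt_eqF// mulr_gt0.
(* [mu] agrees with the solution of the recursion up to [a], for each [a] *)
have muE a : mu a = offspring_mean s s0 s1 V a (fun l => toll f a l + \sum_i mu (l i)).
  have [|u [u0 uE _]] := @offspring_poisson _ _ _ _ _ hs01 hs hb _ _ _ _ hVs hV0 _ beta0 beta1 hV1
    (fun c => offspring_mean s s0 s1 V c (toll f c)) a.
    by rewrite offspring_mean_leaf.
  have {}uE c' : (c' <= a)%N -> u c' = offspring_mean s s0 s1 V c' (fun l => toll f c' l + \sum_i u (l i)).
    by move=> c'a; rewrite {1}uE// offspring_meanD.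
  have muu n : (n <= a)%N -> mu n = u n.
    rewrite /mu; case: n => [|n] na //=; rewrite unlock XE.
    have [|_ <-//] := functional_mean hs01 hVs (hT n.+1 isT) phif psi0 psi00 psiQ u0.
    by move=> c' c'n; apply: uE; apply: leq_trans na.
  rewrite muu// uE//; apply: eq_offspring_mean => // l la; congr (_ + _).
  apply: eq_bigr => i _; apply/esym/muu.
  by rewrite (leq_trans _ la)// (bigD1 i)//= leq_addr.
have muw e : 0 < e -> exists A : nat, forall a, (A <= a)%N ->
    `|mu a - varpi (ln a%:R) * a%:R `^ beta| <= e * a%:R `^ beta.
  move=> e0; have /eqoP /(_ e e0)[A _ HA] := muo.
  exists (maxn 1 A) => a; rewrite geq_max => /andP[a1 Aa].
  have := HA a Aa; rewrite /= [`|_ `^ _|]ger0_norm ?powR_ge0//.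
  by rewrite /mu gtn_eqF.
pose B := B0 + 1.
have wB x : `|varpi x| <= B by apply: HB0 => //; rewrite ltrDl.
have [wu wV] :
   (forall e, 0 < e -> exists2 dl, 0 < dl & forall x y, `|x - y| < dl -> `|varpi x - varpi y| <= e) /\
   {ae P0, forall x, forall i, 0 < V i x -> forall t, varpi (t + ln (V i x)) = varpi t}.
  case: hd => [[hlat _]|[hd0 _]].
    split; first exact: periodic_unif_continuous wper hlat.1 cw.
    apply: filterS (lattice_span_ae (ltnW hb) hlat) => x Hx i Vi t.
    by have [z ->] := Hx i Vi; exact: periodic_int.
  have [k wk] := wconst hd0; split.
    by move=> e e0; exists 1 => // x y _; rewrite !wk subrr normr0 ltW.
  by apply: aeW => x i _ t; rewrite !wk.
have fC a : (1 <= a)%N ->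
    offspring_mean s s0 s1 V a (fun l => f l ^+ 2) <= C * a%:R `^ (2 * (beta - delta)).
  move=> a1; rewrite -lee_fin -(toll_second_moment hs01 hVs (hT a a1) phif)//.
  exact: hC.
pose Y n x := (X n x - fine ('E_P[X n])%E) / (n%:R `^ beta * varpi (ln n%:R)).
have key e : 0 < e -> \forall n \near \oo,
    Y n \in Lfun P 2%:E /\ ('N[P]_2%:E[EFin \o Y n] <= e%:E)%E.
  move=> e0; have ec0 : 0 < (e * c) ^+ 2 by rewrite exprn_gt0// mulr_gt0.
  have [h [h0 hQ [A HA]]] := variance_majorant hs01 hs hb hVs hV0 beta0 beta1 hV1 wB wu wV
     (erefl : mu 0%N = 0) muw delta0 fC ec0.
  exists (maxn 1 A) => // n /=; rewrite geq_max => /andP[n1 An].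
  have nR : 0 < n%:R :> R by rewrite ltr0n.
  have nb0 : 0 < n%:R `^ beta by rewrite powR_gt0.
  have iV := functional_var hs01 hVs (hT n n1) phif psi0 psiQ (erefl : mu 0%N = 0)
    (fun a _ => muE a) h0 (fun a _ => hQ a).
  have mXn : measurable_fun setT (X n).
    by rewrite XE; exact: (measurable_functional (hT n n1) phif).
  have muX : fine ('E_P[X n])%E = mu n by rewrite /mu gtn_eqF.
  set D := n%:R `^ beta * varpi (ln n%:R).
  have D0 : 0 < D ^+ 2.
    have wne : varpi (ln n%:R) != 0 by rewrite -normr_gt0; exact: lt_le_trans c0 (wc _).
    by rewrite exprn_even_gt0//= mulf_neq0// gt_eqF.
  have mY : measurable_fun setT (Y n).
    apply: measurable_funM; last exact: measurable_cst.
    by apply: measurable_funB => //; exact: measurable_cst.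
  apply: L2_norm_le => //; first exact: ltW.
  have -> : (\int[P]_x (Y n x ^+ 2)%:E =
     \int[P]_x ((D ^- 2)%:E * ((X n x - mu n) ^+ 2)%:E))%E.
    by apply: eq_integral => x _; rewrite /Y -/D muX -EFinM exprMn exprVn mulrC.
  rewrite ge0_integralZl_EFin//; last 3 first.
  - by move=> x _; rewrite lee_fin sqr_ge0.
  - apply/measurable_EFinP; apply: measurable_funX; apply: measurable_funB => //.
  - by rewrite invr_ge0 ltW.
  have le1 : (\int[P]_x ((X n x - mu n) ^+ 2)%:E <= (e ^+ 2 * D ^+ 2)%:E)%E.
    rewrite XE; apply: le_trans iV _; rewrite lee_fin.
    apply: le_trans (HA _ An) _; rewrite powR_double -!exprMn.
    rewrite -[leRHS]real_normK ?num_real// lerXn2r ?nnegrE ?mulr_ge0 ?powR_ge0//.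
    - exact: ltW.
    - exact: ltW.
    rewrite /D !normrM (gtr0_norm e0) (gtr0_norm nb0) -mulrA.
    by rewrite ler_pM2l// mulrC ler_pM2l.
  apply: le_trans (_ : (D ^- 2)%:E * (e ^+ 2 * D ^+ 2)%:E <= _)%E.
    by rewrite lee_pmul2l// lte_fin invr_gt0.
  by rewrite -EFinM lee_fin mulrCA mulVf ?gt_eqF// mulr1.
split.
  by apply: filterS (key 1 ltr01) => n [].
apply/fine_cvgP; split.
  apply: filterS (key 1 ltr01) => n [_ N1].
  by rewrite ge0_fin_numE ?Lnorm_ge0// (le_lt_trans N1) ?ltry.
apply/cvgrPdist_le => e e0; apply: filterS (key e e0) => n [_ Ne].
rewrite sub0r normrN ger0_norm ?fine_ge0 ?Lnorm_ge0//.
rewrite -lee_fin fineK//.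
by rewrite ge0_fin_numE ?Lnorm_ge0// (le_lt_trans Ne) ?ltry.
Qed.
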